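(* The only trees that admit proper Laplacian fractional revival are $K_2$ and the path $P_3$ on three vertices.
   Context: For a graph $X$ with adjacency matrix $A$ and diagonal degree matrix $D$, the Laplacian is $L=D-A$ and the transition matrix is $U(t)=\exp(itL)$. $X$ admits Laplacian fractional revival from vertex $a$ to vertex $b\neq a$ at time $\tau$ if $U(\tau)e_a=\alpha e_a+\beta e_b$ for some complex $\alpha,\beta$; it is proper if $\beta\neq0$. *)

(* Defs.v *)
From HB Require Import structures.
From mathcomp Require Import all_boot all_order all_algebra.
From mathcomp Require Import all_classical all_reals all_analysis.
From mathcomp Require Import complex.

Set Implicit Arguments.
Unset Strict Implicit.
Unset Printing Implicit Defensive.

Import Order.TTheory GRing.Theory Num.Theory.
Import numFieldNormedType.Exports.

Local Open Scope classical_set_scope.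
Local Open Scope ring_scope.
Local Open Scope complex_scope.

(* The library puts no topology on the concrete type R[i].  We give it the one
   induced by the modulus, which every numFieldType K carries on K^o; matrices
   over R[i] then get their sup norm from the library. *)
HB.instance Definition _ (R : realType) := NormedModule.copy R[i] (R[i]^o).

Record sgraph := SGraph {
  vertex :> finType;
  adj : rel vertex;
  adj_sym : symmetric adj;
  adj_irrefl : irreflexive adj }.

Definition connected_graph (X : sgraph) : Prop :=
  (0 < #|X|)%N /\ forall x y : X, connect (@adj X) x y.

(* [cycle e s] closes up s, so the length bound excludes the degenerate closed
   walks x, y, x along a single edge. *)
Definition acyclic_graph (X : sgraph) : Prop :=
  forall s : seq X, (2 < size s)%N -> ~ ucycle (@adj X) s.

Definition is_tree (X : sgraph) : Prop := connected_graph X /\ acyclic_graph X.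

Definition graph_iso (X Y : sgraph) : Prop :=
  exists2 f : X -> Y, bijective f & forall x y, adj (f x) (f y) = adj x y.

Definition complete_rel n : rel 'I_n := [rel i j : 'I_n | i != j].

Lemma complete_rel_sym n : symmetric (@complete_rel n).
Proof. by move=> i j; rewrite /complete_rel /= eq_sym. Qed.

Lemma complete_rel_irrefl n : irreflexive (@complete_rel n).
Proof. by move=> i; rewrite /complete_rel /= eqxx. Qed.

Definition complete_graph n : sgraph :=
  SGraph (@complete_rel_sym n) (@complete_rel_irrefl n).

Definition path_rel n : rel 'I_n :=
  [rel i j : 'I_n | (i.+1 == j) || (j.+1 == i)].

Lemma path_rel_sym n : symmetric (@path_rel n).
Proof. by move=> i j; rewrite /path_rel /= orbC. Qed.

Lemma path_rel_irrefl n : irreflexive (@path_rel n).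
Proof. by move=> i; rewrite /path_rel /= orbb gtn_eqF. Qed.

(* The path with n vertices. *)
Definition path_graph n : sgraph :=
  SGraph (@path_rel_sym n) (@path_rel_irrefl n).

Section Laplacian.
Variables (R : realType) (X : sgraph).

Definition degree (x : X) : nat := #|adj x|.

(* Vertices index rows and columns through enum_val / enum_rank. *)
Definition adj_mx : 'M[R[i]]_#|X| :=
  \matrix_(i, j) (adj (enum_val i) (enum_val j))%:R.

Definition degree_mx : 'M[R[i]]_#|X| :=
  diag_mx (\row_j (degree (enum_val j))%:R).

Definition laplacian_mx : 'M[R[i]]_#|X| := degree_mx - adj_mx.

Definition vertex_vec (a : X) : 'cV[R[i]]_#|X| := delta_mx (enum_rank a) 0.

End Laplacian.

Definition expmx (R : realType) n (A : 'M[R[i]]_n) : 'M[R[i]]_n :=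
  lim (series (fun k => (k`!%:R^-1 : R[i]) *: A ^+ k) @ \oo).

Definition transition_mx (R : realType) (X : sgraph) (t : R) :
    'M[R[i]]_#|X| :=
  expmx (('i%C * t%:C) *: laplacian_mx R X).

Definition proper_laplacian_FR (R : realType) (X : sgraph) (a b : X) (tau : R) :
    Prop :=
  a <> b /\
  exists alpha beta : R[i],
    beta <> 0 /\
    transition_mx X tau *m vertex_vec R a =
      alpha *: vertex_vec R a + beta *: vertex_vec R b.

Definition admits_proper_laplacian_FR (R : realType) (X : sgraph) : Prop :=
  exists (a b : X) (tau : R), proper_laplacian_FR a b tau.

(* Main.v *)
(** Put [s = e_a + e_b] and [f = e_a - e_b].  Unitarity, symmetry and the
    invariance of the all-ones vector give [U s = s] and [U f = w f] with
    [w <> 1].  Hence the eigenvalues [t] supporting [s] satisfy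
    [exp (i tau t) = 1], so they are integer multiples of [2 pi / tau]; as the
    polynomial vanishing on the support of an integer vector is rational, their
    sum is rational, which makes [2 pi / tau] rational and all the eigenvalues
    supporting [s] or [f] integers.

    In a tree, a vector whose Laplacian vanishes mod [m] is constant mod [m].
    Applied to an integer eigenvector with opposite values at [a] and [b], this
    bounds the eigenvalues supporting [f] by 2, so [(L - 1) (L - 2) f = 0]; its
    coordinates at [a] and [b] force either [K_2] or two leaves [a], [b] with a
    common neighbour [c].  In the latter case [L f = f] and [L s = s - 2 e_c], so
    1 does not support [s].  If 2 does, every eigenvalue supporting [s] is even,
    and [L s = s] mod 2 makes [s] vanish mod 2, which is absurd.  Otherwise they
    are 0 or at least 3 while [<s, L (L - 3) s> = 0], so [L (L - 3) s = 0], which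
    fails at a third neighbour of [c]. *)

Require Import Defs.
From mathcomp Require Import all_boot all_order all_algebra.
From mathcomp Require Import all_classical all_reals all_analysis.
From mathcomp Require Import algC algnum complex zify ring lra.

Set Implicit Arguments.
Unset Strict Implicit.
Unset Printing Implicit Defensive.

Import Order.TTheory GRing.Theory Num.Theory.
Import numFieldNormedType.Exports.

Local Open Scope classical_set_scope.
Local Open Scope ring_scope.
Local Open Scope sesquilinear_scope.
Local Open Scope complex_scope.

(** * The matrix exponential *)

Lemma expr_scaled_diag_conj (K : comUnitRingType) n (P : 'M[K]_n) (v : 'rV[K]_n) c k :
  P \in unitmx ->
  (c *: (invmx P *m diag_mx v *m P)) ^+ k =
  invmx P *m diag_mx (\row_j (c * v 0 j) ^+ k) *m P.
Proof.
move=> Pu; rewrite scalemxAl scalemxAr -linearZ; elim: k => [|k IH].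
  rewrite expr0; have -> : diag_mx (\row_j (c * v 0 j) ^+ 0) = 1%:M.
    by apply/matrixP => i j; rewrite !mxE expr0.
  by rewrite mulmx1 mulVmx.
rewrite exprS IH -[LHS]/(_ *m _) !mulmxA mulmxK //.
rewrite -[_ *m _ *m diag_mx _]mulmxA mulmx_diag.
by congr (_ *m diag_mx _ *m _); apply/rowP => j; rewrite !mxE exprS.
Qed.

Section Cis.
Variable R : realType.
Implicit Types x y t : R.

Definition cis t : R[i] := cos t +i* sin t.

Lemma cis0 : cis 0 = 1.
Proof. by rewrite /cis cos0 sin0. Qed.

Lemma cisD x y : cis (x + y) = cis x * cis y.
Proof.
by apply/eqP; rewrite eq_complex /cis /= cosD sinD [sin x * _ + _]addrC !eqxx.
Qed.

Lemma cis_conj x : (cis x)^* = cis (- x).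
Proof. by rewrite /cis /= cosN sinN. Qed.

Lemma cis_neq0 x : cis x != 0.
Proof.
apply/eqP => h; have := cisD x (- x); rewrite h mul0r subrr cis0 => /eqP.
by rewrite oner_eq0.
Qed.

Lemma cis_2pi_int (k : int) : cis (k%:~R * (pi *+ 2)) = 1.
Proof.
have c2 : cis (pi *+ 2) = 1 by rewrite /cis cos2pi sin2pi.
have cn (n : nat) : cis (n%:R * (pi *+ 2)) = 1.
  elim: n => [|n IH]; first by rewrite mul0r cis0.
  by rewrite -natr1 mulrDl mul1r cisD IH c2 mulr1.
case: k => n; first exact: cn.
rewrite NegzE mulrNz mulNr.
have := cisD (- (n.+1%:R * (pi *+ 2))) (n.+1%:R * (pi *+ 2)).
by rewrite addNr cis0 cn mulr1.
Qed.

Lemma cis_eq1P t : cis t = 1 <-> exists k : int, t = k%:~R * (pi *+ 2).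
Proof.
split=> [h|[k ->]]; last exact: cis_2pi_int.
have p0 : (0 : R) < pi *+ 2 by rewrite pmulrn_rgt0 ?pi_gt0.
pose k := Num.floor (t / (pi *+ 2)).
pose u := t - k%:~R * (pi *+ 2).
have /andP[ku1 ku2] := floor_itv (t / (pi *+ 2)).
have u0 : 0 <= u by rewrite subr_ge0 -ler_pdivlMr.
have u2 : u < pi *+ 2.
  by rewrite ltrBlDr -[X in X + _]mul1r -mulrDl -ltr_pdivrMr //;
    move: ku2; rewrite intrD [1 + _]addrC.
have ck : cis (k%:~R * (pi *+ 2)) = 1 by exact: cis_2pi_int.
have hu : cis u = 1.
  by have := cisD u (k%:~R * (pi *+ 2)); rewrite subrK h ck mulr1.
exists k; apply/eqP; rewrite -subr_eq0 -/u; apply/negPn/negP => un0.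
(* By the double-angle formula [cos u = 1] forces [sin (u / 2) = 0], while sine is positive strictly
   between 0 and pi. *)
have u20 : 0 < u / 2 < pi.
  have up : 0 < u by rewrite lt_def un0.
  by move: u2; rewrite -mulr_natr => u2; apply/andP; split; lra.
have := sin_gt0_pi u20; have := cos_mulr2n (u / 2); have := cos2Dsin2 (u / 2).
rewrite -[u / 2 *+ 2]mulr_natr divfK // -mulr_natr; case: hu => -> _; nra.
Qed.

Lemma cis_coeffE t (k : nat) :
  k`!%:R^-1 * ('i * t%:C) ^+ k = cos_coeff t k +i* sin_coeff t k.
Proof.
have -> : (k`!%:R^-1 : R[i]) = (k`!%:R^-1 : R)%:C by rewrite fmorphV rmorph_nat.
have hi m : ('i%C : R[i]) ^+ m.*2 = ((-1) ^+ m : R)%:C.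
  by rewrite -mul2n exprM sqr_i rmorphXn rmorphN1.
rewrite exprMn -rmorphXn /cos_coeff /sin_coeff /=.
have e : (k = odd k + k./2.*2)%N by rewrite odd_double_half.
case o : (odd k) e => /=; rewrite ?add0n ?add1n => e.
  have -> : k.-1./2 = k./2 by rewrite {1}e /= doubleK.
  rewrite {2}e exprS hi; apply/eqP; rewrite eq_complex; simpc.
  by rewrite /= [k`!%:R^-1 * _]mulrC -?exprnP eqxx.
rewrite {2}e hi; apply/eqP; rewrite eq_complex; simpc.
  by rewrite /= [k`!%:R^-1 * _]mulrC -?exprnP eqxx.
Qed.

Lemma cvg_complex (u v : R^nat) a b :
  u @ \oo --> a -> v @ \oo --> b ->
  (fun n => u n +i* v n : R[i]) @ \oo --> (a +i* b : R[i]).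
Proof.
move=> /cvgrPdist_lt ua /cvgrPdist_lt vb; apply/cvgrPdist_lt => -[e ei].
(* A positive element of [R[i]] has zero imaginary part, so the radius is real. *)
rewrite ltcE /= => /andP[/eqP -> e0].
have e20 : 0 < e / 2 by rewrite divr_gt0.
near=> n.
have h1 : `|a - u n| < e / 2 by near: n; exact: ua.
have h2 : `|b - v n| < e / 2 by near: n; exact: vb.
have -> : (a +i* b) - (u n +i* v n) = (a - u n)%:C + 'i%C * (b - v n)%:C :> R[i].
  by apply/eqP; rewrite eq_complex; simpc.
have nC (x : R) : `|x%:C| = `|x|%:C :> R[i].
  by rewrite normc_def /= expr0n addr0 sqrtr_sqr.
apply: (le_lt_trans (ler_normD _ _)).
rewrite normrM nC nC; have -> : `|'i%C| = 1 :> R[i].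
  by rewrite normc_def /= expr0n add0r expr1n sqrtr1.
by rewrite mul1r -rmorphD ltcR [e]splitr ltrD.
Unshelve. all: by end_near. Qed.

Lemma cvg_series_cis t :
  series (fun k => k`!%:R^-1 * ('i * t%:C) ^+ k) @ \oo --> cis t.
Proof.
have -> : series (fun k => k`!%:R^-1 * ('i * t%:C) ^+ k) =
    (fun n => series (cos_coeff t) n +i* series (sin_coeff t) n).
  apply/funext => n; rewrite /series /=; elim: n => [|n IH].
    by rewrite !big_geq.
  by rewrite !big_nat_recr //= IH cis_coeffE.
apply: cvg_complex; rewrite unlock.
- exact: is_cvg_series_cos_coeff.
- exact: is_cvg_series_sin_coeff.
Qed.

(** A neighbourhood of a matrix contains a product of neighbourhoods of its entries, and finitely
    many eventual conditions hold together eventually. *)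
Lemma cvg_mx m n (F : nat -> 'M[R[i]]_(m, n)) (M : 'M[R[i]]_(m, n)) :
  (forall i j, (fun k => F k i j) @ \oo --> M i j) -> F @ \oo --> M.
Proof.
move=> h A [P MP sPA].
have : \forall k \near \oo, forall ij : 'I_m * 'I_n, P ij.1 ij.2 (F k ij.1 ij.2).
  by apply: filter_forall => ij; apply: h; apply: MP.
by apply: filterS => k hk; apply: sPA => i j; apply: (hk (i, j)).
Qed.

(** Conjugation by [P] passes through the partial sums, so each entry is a fixed finite combination
    of scalar exponential series converging to [cis]. *)
Lemma expmx_diag n (P : 'M[R[i]]_n) (d : 'rV[R]_n) (t : R) : P \in unitmx ->
  expmx (('i * t%:C) *: (invmx P *m diag_mx (map_mx (real_complex R) d) *m P)) =
  invmx P *m diag_mx (\row_j cis (t * d 0 j)) *m P.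
Proof.
move=> Pu; set D := diag_mx _; set c := 'i%C * t%:C.
have hX k : (c *: (invmx P *m D *m P)) ^+ k =
    invmx P *m diag_mx (\row_j (c * (d 0 j)%:C) ^+ k) *m P.
  rewrite (expr_scaled_diag_conj _ _ _ Pu).
  have -> : \row_j (c * map_mx (real_complex R) d 0 j) ^+ k =
      \row_j (c * (d 0 j)%:C) ^+ k.
    by apply/rowP => j; rewrite !mxE.
  by [].
apply: cvg_lim; first exact: norm_hausdorff.
apply: cvg_mx => i j.
have -> : (fun k => series (fun k => k`!%:R^-1 *: (c *: (invmx P *m D *m P)) ^+ k) k i j)
  = (fun k => \sum_(l < n) (invmx P i l *
       (series (fun k => k`!%:R^-1 * ('i * (t * d 0 l)%:C) ^+ k) k * P l j))).
  apply/funext => k; rewrite /series /= summxE.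
  transitivity (\sum_(0 <= m < k) \sum_(l < n)
      m`!%:R^-1 * (invmx P i l * ((c * (d 0 l)%:C) ^+ m * P l j))).
    apply: eq_bigr => m _; rewrite hX mxE -mulmxA mul_diag_mx mxE mulr_sumr.
    by apply: eq_bigr => l _; rewrite !mxE.
  rewrite exchange_big /=; apply: eq_bigr => l _.
  rewrite mulr_suml mulr_sumr; apply: eq_bigr => m _.
  by rewrite /c rmorphM /= !mulrA [_^-1 * invmx P i l]mulrC.
have -> : (invmx P *m diag_mx (\row_j cis (t * d 0 j)) *m P) i j =
    \sum_(l < n) (invmx P i l * (cis (t * d 0 l) * P l j)).
  by rewrite -mulmxA mul_diag_mx mxE; apply: eq_bigr => l _; rewrite !mxE.
apply: cvg_big => [|l _]; first exact: add_continuous.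
by apply: cvgMl_tmp; apply: cvgMr_tmp; apply: cvg_series_cis.
Qed.
End Cis.

(** * Spectral support of an integer vector *)

(** The root is an algebraic integer in [algC], and rational algebraic integers are integers. *)
Lemma rat_root_monic_int (p : {poly int}) (q : rat) :
  p \is monic -> root (map_poly intr p) q -> q \is a Num.int.
Proof.
move=> pm pq; pose qC : algC := ratr q.
have rC : root (map_poly intr p) qC.
  have -> : map_poly intr p = map_poly ratr (map_poly intr p : {poly rat}) :> {poly algC}.
    by rewrite -map_poly_comp; apply: eq_map_poly => x /=; rewrite ratr_int.
  by rewrite fmorph_root.
have qA : qC \in Aint.
  apply: (root_monic_Aint rC); first exact: monic_map.
  by apply/polyOverP => i; rewrite coef_map /= rpred_int.
have /intrP [m hm] := Cint_rat_Aint (Crat_rat q) qA.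
apply/intrP; exists m; apply: (fmorph_inj (@ratr algC)).
by rewrite [RHS]ratr_int -hm.
Qed.

Section ShiftProd.
Variables (n : nat).

(** The product of the operators [A - a], [a] in [l], applied to [v]. The ring is arbitrary so that
    identities proved over [R[i]] can be pulled back to [int]. *)
Definition shift_prod (K : nzRingType) (A : 'M[K]_n) (l : seq K) (v : 'cV[K]_n) :=
  foldr (fun a w => A *m w - a *: w) v l.

Lemma map_shift_prod (K K' : nzRingType) (f : {rmorphism K -> K'}) A l v :
  map_mx f (shift_prod A l v) = shift_prod (map_mx f A) (map f l) (map_mx f v).
Proof. by elim: l => //= a l <-; rewrite map_mxB map_mxM map_mxZ. Qed.
End ShiftProd.

Lemma intr_mx_inj (K : numDomainType) m n :
  injective (map_mx (intr : int -> K) : 'M[int]_(m, n) -> 'M[K]_(m, n)).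
Proof.
move=> A B /matrixP h; apply/matrixP => i j; have := h i j.
by rewrite !mxE; apply: intr_inj.
Qed.

(** The spectral theorem for Hermitian matrices; the eigenvalues being real, [d] can be taken in
    [R], where it is ordered. *)
Lemma real_sym_spectral (R : realType) n (L : 'M[R[i]]_n) :
  L^T = L -> (forall i j, L i j \is Num.real) ->
  exists (P : 'M[R[i]]_n) (d : 'rV[R]_n),
    P \is unitarymx /\ L = invmx P *m diag_mx (map_mx (real_complex R) d) *m P.
Proof.
move=> Ls Lr.
have Lh : L \is hermsymmx.
  apply: realsym_hermsym; last by apply/mxOverP.
  by apply/is_hermitianmxP; rewrite expr0 scale1r map_mx_id.
have /orthomx_spectralP e := hermitian_normalmx Lh.
exists (spectralmx L), (map_mx (@complex.Re R) (spectral_diag L)).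
split; first exact: spectral_unitarymx.
have <- : spectral_diag L =
    map_mx (real_complex R) (map_mx (@complex.Re R) (spectral_diag L)).
  apply/rowP => j; rewrite !mxE.
  have /mxOverP/(_ 0 j) h := hermitian_spectral_diag_real Lh.
  by rewrite RRe_real.
exact: e.
Qed.

Section Spectral.
Variables (R : realType) (n : nat) (M : 'M[int]_n) (P : 'M[R[i]]_n) (d : 'rV[R]_n).
Hypothesis Pu : P \is unitarymx.
Let L : 'M[R[i]]_n := map_mx intr M.
Hypothesis Ldiag : L = invmx P *m diag_mx (map_mx (real_complex R) d) *m P.

Definition scoord (v : 'cV[R[i]]_n) i := (P *m v) i 0.

Lemma scoord_inj u v : (forall i, scoord u i = scoord v i) -> u = v.
Proof.
move=> h; have : P *m u = P *m v by apply/colP => i; apply: h.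
by move/(congr1 (mulmx (invmx P))); rewrite !mulKmx ?unitarymx_unit.
Qed.

Lemma scoordB u v i : scoord (u - v) i = scoord u i - scoord v i.
Proof. by rewrite /scoord mulmxBr !mxE. Qed.

Lemma scoordN u i : scoord (- u) i = - scoord u i.
Proof. by rewrite /scoord mulmxN !mxE. Qed.

Lemma scoord_sum (I : finType) (F : I -> 'cV[R[i]]_n) i :
  scoord (\sum_k F k) i = \sum_k scoord (F k) i.
Proof. by rewrite /scoord mulmx_sumr summxE. Qed.

Lemma scoordZ a v i : scoord (a *: v) i = a * scoord v i.
Proof. by rewrite /scoord -scalemxAr !mxE. Qed.

Lemma scoord_mul v i : scoord (L *m v) i = (d 0 i)%:C * scoord v i.
Proof.
rewrite /scoord Ldiag !mulmxA mulmxV ?unitarymx_unit // mul1mx -mulmxA mul_diag_mx.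
by rewrite !mxE.
Qed.

Lemma scoord_shift_prod l v i :
  scoord (shift_prod L l v) i = (\prod_(a <- l) ((d 0 i)%:C - a)) * scoord v i.
Proof.
elim: l => [|a l IH] /=; first by rewrite big_nil mul1r.
by rewrite scoordB scoord_mul scoordZ IH big_cons -mulrBl mulrA.
Qed.

Lemma scoord_pow k v i : scoord (L ^+ k *m v) i = (d 0 i)%:C ^+ k * scoord v i.
Proof.
elim: k => [|k IH]; first by rewrite !expr0 mul1mx mul1r.
by rewrite exprS -[L * _]/(L *m _) -mulmxA scoord_mul IH exprS mulrA.
Qed.

Variable z : 'cV[int]_n.
Let zC : 'cV[R[i]]_n := map_mx intr z.

(** The eigenvalues with a nonzero component of [z] in their eigenspace. Duplicates are removed so
    that these are the simple roots of the minimal polynomial of [z]. *)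
Definition esupp : seq R := undup [seq d 0 i | i <- enum 'I_n & scoord zC i != 0].

Lemma esuppP t : reflect (exists2 i, scoord zC i != 0 & t = d 0 i) (t \in esupp).
Proof.
rewrite mem_undup; apply: (iffP mapP) => [[j]|[i h ->]].
  by rewrite mem_filter => /andP[h _] ->; exists j.
by exists i; rewrite // mem_filter h mem_enum.
Qed.

(** In each spectral coordinate the operator is multiplication by the product of the [d 0 i - a],
    which vanishes wherever [z] has a nonzero coordinate. *)
Lemma shift_prod_eq0 (l : seq int) :
  {subset esupp <= map intr l} -> shift_prod M l z = 0.
Proof.
move=> sl; apply: (@intr_mx_inj R[i]).
rewrite map_shift_prod map_mx0; apply: scoord_inj => i.
rewrite scoord_shift_prod -/zC [RHS]/scoord mulmx0 mxE.
have [->|h] := eqVneq (scoord zC i) 0; first by rewrite mulr0.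
have /sl /mapP[a al e] : d 0 i \in esupp by apply/esuppP; exists i.
rewrite big_map (big_rem a) //= e.
by rewrite rmorph_int subrr !mul0r.
Qed.

Lemma shift_prod_neq0 (l : seq int) (t : R) :
  t \in esupp -> t \notin map intr l -> shift_prod M l z != 0.
Proof.
move=> /esuppP[i wi ->] tl; apply: contra_neq wi => h.
have := scoord_shift_prod (map intr l) zC i.
rewrite -map_shift_prod h map_mx0 {1}/scoord mulmx0 mxE => /esym/eqP.
rewrite mulf_eq0 => /orP[|/eqP//].
rewrite big_map => /eqP h0; exfalso; move: h0; apply/eqP.
rewrite prodf_seq_neq0; apply/allP => a al /=.
rewrite subr_eq0; apply: contra tl => /eqP e; apply/mapP; exists a => //.
by apply: (@complexI R); rewrite e rmorph_int.
Qed.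

(** The monic [Q] with the support as simple roots annihilates [z], which expresses [L ^+ m *m zC]
    through lower powers of [L] applied to [zC]. These vectors come from rational ones and the
    relation is unique, so [Q] is rational; its coefficient of degree [m.-1] is minus the sum of the
    support. *)
Lemma esupp_sum_rat : exists q : rat, \sum_(t <- esupp) t = ratr q.
Proof.
case: (posnP (size esupp)) => [/size0nil ->|s0].
  by exists 0; rewrite big_nil rmorph0.
set m := size esupp in s0.
pose ps : seq R[i] := map (real_complex R) esupp.
pose Q := \prod_(a <- ps) ('X - a%:P).
have sps : size ps = m by rewrite size_map.
have sQ : size Q = m.+1 by rewrite size_prod_XsubC sps.
have Qm : Q`_m = 1.
  by have := monic_prod_XsubC ps xpredT id => /monicP; rewrite lead_coefE -/Q sQ.
pose zQ : 'cV[rat]_n := map_mx intr z.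
pose MQ : 'M[rat]_n := map_mx intr M.
have e0 : L ^+ m *m zC = - \sum_(k < m) Q`_k *: (L ^+ k *m zC).
  apply: scoord_inj => i; rewrite scoord_pow scoordN scoord_sum.
  under eq_bigr => k _ do rewrite scoordZ scoord_pow mulrA.
  rewrite -mulr_suml -mulNr.
  have [->|h] := eqVneq (scoord zC i) 0; first by rewrite !mulr0.
  congr (_ * _); apply/eqP; rewrite -addr_eq0 addrC.
  have := horner_coef Q (d 0 i)%:C; rewrite sQ big_ord_recr /= Qm mul1r => <-.
  rewrite -rootE root_prod_XsubC; apply: map_f; apply/esuppP.
  by exists i.
pose KQ := \matrix_(k < m) (MQ ^+ k *m zQ)^T.
have hmap k : map_mx (@ratr R[i]) (MQ ^+ k *m zQ) = L ^+ k *m zC.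
  have hz : map_mx (@ratr R[i]) zQ = zC.
    by apply/colP => i; rewrite !mxE ratr_int.
  have hM : map_mx (@ratr R[i]) MQ = L.
    by apply/matrixP => i j; rewrite !mxE ratr_int.
  elim: k => [|k IH]; first by rewrite !expr0 !mul1mx.
  rewrite !exprS -[MQ * _]/(MQ *m _) -[L * _]/(L *m _) -!mulmxA map_mxM IH.
  by rewrite hM.
have hrow k : row k (map_mx (@ratr R[i]) KQ) = (L ^+ k *m zC)^T.
  by rewrite -hmap; apply/rowP => j; rewrite !mxE.
(* Membership in a row space is unaffected by field extension, so the complex relation [e0] yields a
   rational one. *)
have sub : ((MQ ^+ m *m zQ)^T <= KQ)%MS.
  rewrite -(map_submx (@ratr R[i])); apply/submxP.
  exists (\row_k - Q`_k); rewrite -map_trmx hmap e0 mulmx_sum_row.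
  rewrite linearN linear_sum -sumrN; apply: eq_bigr => k _.
  by rewrite hrow mxE scaleNr linearZ.
case/submxP: sub => u hu.
have e1 : L ^+ m *m zC = \sum_(k < m) (ratr (u 0 k)) *: (L ^+ k *m zC).
  apply: trmx_inj; rewrite -hmap map_trmx hu map_mxM mulmx_sum_row linear_sum.
  by apply: eq_bigr => k _; rewrite hrow mxE linearZ.
(* Both relations hold in each nonzero spectral coordinate, so [D], of size at most [m], has the [m]
   distinct supporting eigenvalues as roots. *)
pose D := rVpoly (\row_(k < m) (Q`_k + ratr (u 0 k))).
have D0 : D = 0.
  apply: (@roots_geq_poly_eq0 _ _ ps); last by rewrite sps size_poly.
    apply/allP => _ /mapP[t /esuppP[i wi ->] ->].
    rewrite rootE (horner_coef_wide _ (size_poly _ _)).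
    have := e1; rewrite e0 => /(congr1 (scoord^~ i)).
    rewrite scoordN !scoord_sum.
    under eq_bigr => k _ do rewrite scoordZ scoord_pow mulrA.
    under [RHS]eq_bigr => k _ do rewrite scoordZ scoord_pow mulrA.
    rewrite -!mulr_suml -mulNr => /(mulIf wi) h.
    under eq_bigr => k _ do rewrite coef_rVpoly_ord mxE mulrDl.
    by rewrite big_split /= -h subrr.
  by rewrite map_inj_uniq ?undup_uniq //; exact: complexI.
have m1 : (m.-1 < m)%N by rewrite prednK.
have := congr1 (fun p : {poly R[i]} => p`_(Ordinal m1)) D0.
rewrite /D coef_rVpoly_ord mxE coef0 /=.
have -> : Q`_m.-1 = - \sum_(p <- ps) p.
  by rewrite -sps coefPn_prod_XsubC // sps -lt0n.
rewrite big_map -rmorph_sum /= => /eqP; rewrite addrC subr_eq0 => /eqP h.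
exists (u 0 (Ordinal m1)); apply: (@complexI R).
by rewrite -h fmorph_rat.
Qed.

(** Eigenvalues of [M] are roots of its characteristic polynomial, which is monic with integer
    coefficients. *)
Lemma esupp_rat_int (q : rat) : ratr q \in esupp -> q \is a Num.int.
Proof.
case/esuppP => i _ e.
apply: (@rat_root_monic_int (char_poly M)); first exact: char_poly_monic.
have : eigenvalue L (d 0 i)%:C.
  (* [eigenvalue] refers to row vectors, and the rows of [P] are left eigenvectors, nonzero as [P]
     is invertible. *)
  apply/eigenvalueP; exists (row i P).
    rewrite Ldiag -row_mul !mulmxA mulmxV ?unitarymx_unit // mul1mx.
    by rewrite row_mul row_diag_mx -scalemxAl -rowE mxE.
  apply: contraTneq (unitarymx_unit Pu) => h.
  rewrite -row_free_unit -kermx_eq0; apply/negP => /eqP hk.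
  have : delta_mx 0 i *m P = 0 :> 'rV_n by rewrite -rowE.
  move/sub_kermxP; rewrite hk submx0 => /eqP/rowP/(_ i).
  by rewrite !mxE !eqxx => /eqP; rewrite oner_eq0.
rewrite eigenvalue_root_char -e /L -map_char_poly.
have -> : (ratr q)%:C = ratr q :> R[i] by rewrite fmorph_rat.
have -> : map_poly intr (char_poly M) =
    map_poly ratr (map_poly intr (char_poly M) : {poly rat}) :> {poly R[i]}.
  by rewrite -map_poly_comp; apply: eq_map_poly => x /=; rewrite ratr_int.
by rewrite fmorph_root.
Qed.

End Spectral.

(** * Laplacians of trees *)

Section Bridge.
Variable X : sgraph.
Hypothesis Xacyc : acyclic_graph X.

Let del (u v : X) : rel X :=
  [rel p q | adj p q && ((p, q) != (u, v)) && ((p, q) != (v, u))].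

(** A simple path from [u] to [v] that avoids the edge would be closed by it into a cycle. *)
Lemma edge_is_bridge (u v : X) : adj u v -> ~~ connect (del u v) u v.
Proof.
move=> uv; apply/negP => /connectP[p0 /shortenP[p pth up _] lst].
apply: (Xacyc (s := u :: p)).
  (* The cycle has at least three vertices: an empty path would make [u] adjacent to itself, and a
     path of one step would be the deleted edge. *)
  case: p pth up lst => [|w [|w' p]] //= pth _ e.
    by move: uv; rewrite e adj_irrefl.
  by move: pth; rewrite -e !andbT /del /= eqxx andbF.
rewrite /ucycle up andbT /= rcons_path -lst adj_sym uv andbT.
by apply: sub_path pth => x y /andP[/andP[]].
Qed.

(* Summing the Laplacian over one side of the cut made by removing an edge
   leaves only the flow through that edge. *)
Lemma lap_dvd_edge (m : int) (x : X -> int) (u v : X) :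
  (forall w, (m %| \sum_(y | adj w y) (x w - x y))%Z) -> adj u v ->
  (m %| x u - x v)%Z.
Proof.
move=> hm uv; have nuv := edge_is_bridge uv.
pose S := [pred w | connect (del u v) u w].
have Su : u \in S by exact: connect0.
have Sv : v \notin S by [].
have : (m %| \sum_(w | w \in S) \sum_(y | adj w y) (x w - x y))%Z.
  by apply: rpred_sum => w _; apply: hm.
have -> : \sum_(w | w \in S) \sum_(y | adj w y) (x w - x y) =
  \sum_(w | w \in S) \sum_(y | adj w y && (y \in S)) (x w - x y) +
  \sum_(w | w \in S) \sum_(y | adj w y && (y \notin S)) (x w - x y).
  by rewrite -big_split; apply: eq_bigr => w _; rewrite (bigID (mem S)).
set T := (X in X + _).
have T0 : T = 0.
  (* The flow between vertices of [S] is antisymmetric, so it cancels in pairs. *)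
  have TN : T = - T.
    rewrite {1}/T (exchange_big_dep (mem S)) /=; last by move=> w y _ /andP[].
    rewrite /T -sumrN; apply: eq_bigr => y yS; rewrite -sumrN.
    rewrite [LHS](eq_bigl (fun i => adj y i && (i \in S))); last first.
      by move=> w; rewrite /= inE yS andbT adj_sym andbC.
    by apply: eq_bigr => w _; rewrite opprB.
  by lia.
(* The edge from [u] to [v] is the only one leaving [S], as any other survives the deletion. *)
rewrite T0 add0r (bigD1 u) //= [X in _ + X]big1 ?addr0; last first.
  move=> w /andP[wS wu]; apply: big1 => y /andP[wy yS].
  case/negP: yS; rewrite inE; apply: (connect_trans wS); apply: connect1.
  rewrite /del /= wy /= !xpair_eqE (negbTE wu) /=; apply/nandP.
  by left; apply: contraNneq Sv => <-.
rewrite (bigD1 v) /= ?uv ?Sv // [X in _ + X]big1 ?addr0 // => y /andP[/andP[uy yS] yv].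
case/negP: yS; rewrite inE; apply: connect1; rewrite /del /= uy /=.
by rewrite !xpair_eqE eqxx (negbTE yv) /=; apply/nandP; left; apply: contraNneq Sv => <-.
Qed.

Hypothesis Xconn : connected_graph X.

(** The congruences across single edges telescope along a walk from [u] to [v]. *)
Lemma lap_dvd (m : int) (x : X -> int) :
  (forall w, (m %| \sum_(y | adj w y) (x w - x y))%Z) ->
  forall u v, (m %| x u - x v)%Z.
Proof.
move=> hm u v; have /connectP[p pth ->] := Xconn.2 u v.
elim: p u pth => [|w p IH] u /=; first by rewrite subrr dvdz0.
move=> /andP[uw /IH h]; have := lap_dvd_edge hm uw.
by move=> h'; have := rpredD h' h; rewrite addrA subrK.
Qed.

(* Descent: the divisibility of [2 * x] by [lam > 2] replaces an integer
   eigenvector [x] by the strictly smaller one [2 * x / lam]. *)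
Lemma eigenvalue_antisym (lam : int) (a b : X) (x : X -> int) :
  2 < lam -> (forall w, \sum_(y | adj w y) (x w - x y) = lam * x w) ->
  x a + x b = 0 -> forall v, x v = 0.
Proof.
move=> lam2 hx hab v.
have [N hN] : exists N : nat, `|x v| <= N%:Z by exists `|x v|%N; rewrite abszE.
elim: N x hx hab hN => [|N IH] x hx hab hN.
  by apply/eqP; rewrite -normr_le0.
have dv : forall w z, (lam %| x w - x z)%Z.
  by apply: lap_dvd => w; rewrite hx dvdz_mulr.
have d2 w : (lam %| 2 * x w)%Z.
  have -> : 2 * x w = (x w - x a) + (x w - x b) by lia.
  by apply: rpredD.
pose y w := ((2 * x w) %/ lam)%Z.
have ey w : 2 * x w = y w * lam by rewrite divzK.
have lam0 : lam != 0 by lia.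
have yv : y v = 0.
  apply: IH.
  - move=> w; apply: (mulIf lam0); rewrite mulr_suml.
    transitivity (2 * \sum_(z | adj w z) (x w - x z)).
      by rewrite mulr_sumr; apply: eq_bigr => z _; rewrite mulrBl -!ey mulrBr.
    by rewrite hx mulrCA ey mulrA.
  - by apply: (mulIf lam0); rewrite mulrDl -!ey -mulrDr hab mulr0 mul0r.
  (* As [lam] is at least 3, [|y v|] is at most two thirds of [|x v|], hence at most [N]. *)
  - by have := ey v; move: hN; nia.
by have := ey v; rewrite yv mul0r; lia.
Qed.
End Bridge.

(** * The Laplacian over an arbitrary ring, read off at vertices *)

Section Lap.
Variable X : sgraph.
Implicit Types (u v w : X).

Definition lap (K : nzRingType) : 'M[K]_#|X| :=
  \matrix_(i, j) ((degree (enum_val i))%:R *+ (i == j)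
                  - (adj (enum_val i) (enum_val j))%:R).

Definition uvec (K : nzRingType) u : 'cV[K]_#|X| := delta_mx (enum_rank u) 0.

Definition entry (K : nzRingType) (x : 'cV[K]_#|X|) u := x (enum_rank u) 0.

Lemma laplacian_mxE R : laplacian_mx R X = lap R[i].
Proof.
apply/matrixP => i j; by rewrite !mxE.
Qed.

Lemma map_lap (K K' : nzRingType) (f : {rmorphism K -> K'}) :
  map_mx f (lap K) = lap K'.
Proof. by apply/matrixP => i j; rewrite !mxE rmorphB rmorphMn !rmorph_nat. Qed.

Lemma map_uvec (K K' : nzRingType) (f : {rmorphism K -> K'}) u :
  map_mx f (uvec K u) = uvec K' u.
Proof. exact: map_delta_mx. Qed.

Lemma lap_sym K : (lap K)^T = lap K.
Proof.
apply/matrixP => i j; rewrite !mxE adj_sym; congr (_ - _).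
by rewrite eq_sym; case: eqVneq => [->|].
Qed.

Section K.
Variable K : comNzRingType.
Implicit Types x y : 'cV[K]_#|X|.

Lemma entry_inj x y : (forall u, entry x u = entry y u) -> x = y.
Proof.
by move=> h; apply/colP => i; have := h (enum_val i); rewrite /entry enum_valK.
Qed.

Lemma entry_uvec u w : entry (uvec K u) w = (w == u)%:R.
Proof. by rewrite /entry !mxE eqxx andbT (inj_eq enum_rank_inj). Qed.

Lemma entryD x y u : entry (x + y) u = entry x u + entry y u.
Proof. by rewrite /entry mxE. Qed.

Lemma entryN x u : entry (- x) u = - entry x u.
Proof. by rewrite /entry mxE. Qed.

Lemma entryZ k x u : entry (k *: x) u = k * entry x u.
Proof. by rewrite /entry mxE. Qed.

Definition entryE := (entryD, entryN, entryZ, entry_uvec).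

Lemma entry_lap x u :
  entry (lap K *m x) u = \sum_(w | adj u w) (entry x u - entry x w).
Proof.
rewrite /entry mxE (reindex (@enum_rank X)) /=; last exact/onW_bij/enum_rank_bij.
under eq_bigr => w _.
  rewrite mxE !enum_rankK mulrBl (inj_eq enum_rank_inj).
  over.
rewrite sumrB sumrB; congr (_ - _).
  rewrite (bigD1 u) //= eqxx big1 ?addr0 => [|w wu]; last first.
    by rewrite eq_sym (negbTE wu) mul0r.
  by rewrite sumr_const mulr_natl.
rewrite [RHS]big_mkcond; apply: eq_bigr => w _.
by case: ifP => _; rewrite ?mul1r ?mul0r.
Qed.

Lemma entry_lap_uvec u w :
  entry (lap K *m uvec K u) w = (degree w)%:R * (w == u)%:R - (adj w u)%:R.
Proof.
rewrite /entry -colE !mxE !enum_rankK (inj_eq enum_rank_inj).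
by case: eqVneq => _; rewrite ?mulr1 ?mulr0.
Qed.

End K.
End Lap.

(** * Local consequences of [(L - 1) (L - 2) f = 0] in an acyclic graph *)

Section Local.
Variable X : sgraph.
Hypothesis Xacyc : acyclic_graph X.
Implicit Types (a b c u v w : X).

Lemma adj_neq u v : adj u v -> u != v.
Proof. by apply: contraTneq => ->; rewrite adj_irrefl. Qed.

Lemma no_triangle a b w : adj a b -> adj a w -> adj w b -> False.
Proof.
move=> ab aw wb; apply: (Xacyc (s := [:: a; w; b])) => //.
rewrite /ucycle /= aw wb adj_sym ab !inE negb_or (adj_neq aw) (adj_neq ab).
by rewrite (adj_neq wb).
Qed.

Lemma common_neighbor_unique a b w v :
  a != b -> adj a w -> adj w b -> adj a v -> adj v b -> w = v.
Proof.
move=> ab aw wb av vb; apply/eqP/negPn/negP => wv.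
apply: (Xacyc (s := [:: a; w; b; v])) => //.
rewrite /ucycle /= aw wb (adj_sym b) vb (adj_sym v) av !inE !negb_or.
rewrite ab wv (adj_neq aw) (adj_neq av) (adj_neq wb).
by rewrite eq_sym (adj_neq vb).
Qed.

Lemma degree_gt0 u v : adj u v -> (0 < degree u)%N.
Proof. by move=> uv; apply/card_gt0P; exists v. Qed.

Lemma degree1_unique u v w : degree u = 1%N -> adj u v -> adj u w -> w = v.
Proof.
move=> /eqP/fintype.card1P[z hz] uv uw.
have := hz v; have := hz w; rewrite !inE /in_mem /= uv uw => /esym/eqP-> /esym/eqP->.
by [].
Qed.

Let f a b : 'cV[int]_#|X| := uvec int a - uvec int b.

(** The hypothesis says that [y = (L - 2) f] is fixed by [L]. Its coordinate at [a] involves [y]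
    only at [a] and its neighbours, where [y] is determined by degrees and adjacency to [b]. *)
Lemma quadratic_coord a b : a != b ->
  lap X int *m (lap X int *m f a b - 2 *: f a b) = lap X int *m f a b - 2 *: f a b ->
  let k := (degree a)%:Z in let l := (degree b)%:Z in
  let cn := #|[pred w | adj a w && adj w b]| in
  (adj a b -> k ^+ 2 - k + l - 1 = cn%:Z) /\
  (~~ adj a b -> k ^+ 2 - 2 * k + 2 = cn%:Z).
Proof.
move=> ab; set y := _ - _ => hy k l cn.
have ba : (b == a) = false by rewrite eq_sym (negbTE ab).
have yE u : entry y u = (degree u)%:Z * ((u == a)%:R - (u == b)%:R)
    - (adj u a)%:R + (adj u b)%:R - 2 * ((u == a)%:R - (u == b)%:R).
  rewrite /y /f mulmxBr !entryE !entry_lap_uvec; set p := (_ == _)%:R; set q := (_ == _)%:R.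
  by rewrite natz; ring.
have ya : entry y a = k + (adj a b)%:R - 2.
  by rewrite yE eqxx (negbTE ab) adj_irrefl /k /=; ring.
have yw w : adj a w -> entry y w = - (if w == b then l - 2 else 0) - 1 + (adj w b)%:R.
  move=> aw; rewrite yE adj_sym aw; have -> : (w == a) = false.
    by rewrite eq_sym (negbTE (adj_neq aw)).
  by case: eqVneq => [->|_] /=; rewrite /l; ring.
have := congr1 (fun z => entry z a) hy; rewrite entry_lap.
rewrite sumrB sumr_const.
rewrite (eq_bigr _ yw) !big_split /= !sumrN sumr_const.
have -> : \sum_(i | adj a i) (adj i b)%:R = cn%:Z :> int.
  rewrite -natz /cn -sum1_card natr_sum [RHS]big_mkcondr [in RHS]big_mkcond.
  rewrite [LHS]big_mkcond; apply: eq_bigr => i _.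
  by case: (adj a i); case: (adj i b).
have -> : \sum_(i | adj a i) (if i == b then l - 2 else 0) = (l - 2) * (adj a b)%:R.
  rewrite -big_mkcondr (eq_bigl (fun i => (i == b) && adj a b)); last first.
    by move=> i; rewrite andbC; case: eqVneq => [->|].
  case: (adj a b).
    by rewrite (eq_bigl (pred1 b)) ?big_pred1_eq ?mulr1 // => i; rewrite andbT.
  by rewrite big_pred0 ?mulr0 // => i; rewrite andbF.
rewrite -/(degree a) ya -[_ *+ degree a]mulr_natr natz -/k.
by move=> eqn; split=> h; rewrite ?h ?(negbTE h) /= in eqn; nia.
Qed.

(** For adjacent [a], [b] there is no triangle, so [k (k - 1) + (l - 1) = 0] with [k], [l] positive.
    Otherwise [(k - 1) ^ 2 + 1] counts the common neighbours, and a second one would close a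
    4-cycle. *)
Lemma quadratic_local a b : a != b ->
  lap X int *m (lap X int *m f a b - 2 *: f a b) = lap X int *m f a b - 2 *: f a b ->
  (adj a b -> degree a = 1%N) /\
  (~~ adj a b -> degree a = 1%N /\ exists2 c, adj a c & adj b c).
Proof.
move=> ab hy; have [h1 h2] := quadratic_coord ab hy.
split=> [aab|nab].
  have := h1 aab; rewrite eq_card0 => [|w].
    have := degree_gt0 aab; have := degree_gt0 (etrans (adj_sym b a) aab); nia.
  by apply/negbTE/negP; rewrite inE => /andP[aw wb]; apply: (no_triangle aab aw wb).
have := h2 nab; set N := [pred w | _].
have N1 : (#|N| <= 1)%N.
  rewrite leqNgt; apply/negP => /fintype.card_gt1P[w [v [wN vN /eqP[]]]].
  by move: wN vN => /andP[aw wb] /andP[av vb]; apply: common_neighbor_unique ab _ _ _ _.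
move=> e; have : (0 < #|N|)%N by nia.
case/card_gt0P => c /andP[ac cb]; split; first by nia.
by exists c => //; rewrite adj_sym.
Qed.

Lemma quadratic_dichotomy a b : a != b ->
  lap X int *m (lap X int *m f a b - 2 *: f a b) = lap X int *m f a b - 2 *: f a b ->
  degree a = 1%N /\ degree b = 1%N /\
  (adj a b \/ ~~ adj a b /\ exists2 c, adj a c & adj b c).
Proof.
move=> ab hy; have [h1 h2] := quadratic_local ab hy.
have ba : b != a by rewrite eq_sym.
have fN : f b a = - f a b by rewrite /f opprB.
have [h3 h4] : (adj b a -> degree b = 1%N) /\
    (~~ adj b a -> degree b = 1%N /\ exists2 c, adj b c & adj a c).
  apply: quadratic_local ba _; rewrite fN scalerN !mulmxN -opprD mulmxN.
  by congr (- _).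
rewrite adj_sym in h3 h4.
case: (boolP (adj a b)) => aab; first by split; [exact: h1|split; [exact: h3|left]].
by have [d1 ex] := h2 aab; have [d2 _] := h4 aab; split; [|split; [|right]].
Qed.

Lemma lap_leaf (K : comNzRingType) a c : degree a = 1%N -> adj a c ->
  lap X K *m uvec K a = uvec K a - uvec K c.
Proof.
move=> da ac; apply: entry_inj => w; rewrite entry_lap_uvec !entryE;
  congr (_ - (nat_of_bool _)%:R).
  by case: eqVneq => [->|]; rewrite ?da ?mulr1 ?mulr0.
by apply/idP/eqP => [|->]; rewrite adj_sym // => /(degree1_unique da ac).
Qed.

End Local.

(** * [K_2] and [P_3] described by named vertices *)

Section Shapes.
Variable X : sgraph.
Implicit Types (a b c x : X).

Lemma connected_closed (S : pred X) a : connected_graph X ->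
  (forall u v, S u -> adj u v -> S v) -> S a -> forall x, S x.
Proof.
move=> [_ conn] cl Sa x; have /connectP[p pth ->] := conn a x.
elim: p a Sa pth => [|w p IH] a Sa //= /andP[aw]; apply: IH.
exact: cl aw.
Qed.

Definition is_edge_graph a b := adj a b /\ forall x, (x == a) || (x == b).

(** The path [P_3] with centre [c] and ends [a], [b]. *)
Definition is_cherry_graph a b c :=
  [/\ a != b, adj a c, adj b c, ~~ adj a b & forall x, [|| x == a, x == b | x == c]].

Lemma edge_graph_iso a b : is_edge_graph a b -> graph_iso X (complete_graph 2).
Proof.
move=> [ab all]; have nab := adj_neq ab.
exists (fun x => if x == a then ord0 else ord_max : 'I_2).
  exists (fun i : 'I_2 => if i == ord0 then a else b) => [x|i].
    by case: (eqVneq x a) => [->|] //= xa; have := all x; rewrite (negbTE xa) => /eqP.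
  case: (unliftP ord0 i) => [j ->|->] /=; last by rewrite eqxx.
  rewrite eq_sym (negbTE nab); apply/val_inj => /=; by case: j => [[]].
move=> x y; have /orP[] := all x => /eqP ->; have /orP[] := all y => /eqP ->;
  rewrite ?eqxx ?[b == a]eq_sym ?(negbTE nab) ?adj_irrefl ?ab //.
by rewrite [RHS]adj_sym ab.
Qed.

Lemma iso_edge_graph : graph_iso X (complete_graph 2) -> exists a b, is_edge_graph a b.
Proof.
move=> [f [g fK gK] hf]; exists (g ord0), (g ord_max); split.
  by rewrite -hf !gK.
move=> x; rewrite -(fK x) !(can_eq gK).
by case: (f x) => [[|[|]]].
Qed.

Lemma cherry_graph_iso a b c : is_cherry_graph a b c -> graph_iso X (path_graph 3).
Proof.
move=> [ab ac bc nab all].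
have nac := adj_neq ac; have nbc := adj_neq bc.
pose o1 : 'I_3 := Ordinal (isT : 1 < 3)%N.
exists (fun x => if x == a then ord0 else if x == c then o1 else ord_max : 'I_3).
  exists (fun i : 'I_3 => if i == ord0 then a else if i == o1 then c else b) => [x|i].
    have /or3P[] := all x => /eqP ->; rewrite ?eqxx ?[b == a]eq_sym ?(negbTE ab) //=.
      by rewrite (negbTE nbc).
    by rewrite [c == a]eq_sym (negbTE nac).
  case: i => [[|[|[|]]]] //= h; rewrite ?eqxx ?[b == a]eq_sym ?[c == a]eq_sym
    ?(negbTE ab) ?(negbTE nac) ?(negbTE nbc); exact/val_inj.
move=> x y; have /or3P[] := all x => /eqP ->; have /or3P[] := all y => /eqP ->;
  rewrite ?eqxx ?[b == a]eq_sym ?[c == a]eq_sym ?(negbTE ab) ?(negbTE nac)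
    ?(negbTE nbc) ?adj_irrefl ?ac ?bc ?(negbTE nab) //;
  rewrite [RHS]adj_sym ?ac ?bc ?(negbTE nab) //.
Qed.

Lemma iso_cherry_graph : graph_iso X (path_graph 3) ->
  exists a b c, is_cherry_graph a b c.
Proof.
move=> [f [g fK gK] hf]; exists (g ord0), (g ord_max), (g (Ordinal (isT : 1 < 3)%N)).
split; rewrite -?hf ?gK ?(can_eq gK) //.
move=> x; rewrite -(fK x) !(can_eq gK).
by case: (f x) => [[|[|[|]]]].
Qed.

Lemma edge_graph_tree a b : is_edge_graph a b -> is_tree X.
Proof.
move=> [ab all]; split.
  split=> [|x y]; first by apply/card_gt0P; exists a.
  have /orP[] := all x => /eqP ->; have /orP[] := all y => /eqP ->;
    rewrite ?connect0 //; apply: connect1 => //; by rewrite adj_sym.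
move=> s s2 /andP[_ us].
have : (size s <= size [:: a; b])%N.
  by apply: uniq_leq_size us _ => x _; rewrite !inE.
by rewrite leqNgt s2.
Qed.

Lemma cherry_graph_tree a b c : is_cherry_graph a b c -> is_tree X.
Proof.
move=> [ab ac bc nab all]; split.
  split=> [|x y]; first by apply/card_gt0P; exists a.
  have hc z : connect (@adj X) z c /\ connect (@adj X) c z.
    by have /or3P[] := all z => /eqP ->; split; rewrite ?connect0 //;
      apply: connect1; rewrite // adj_sym.
  by have [h _] := hc x; have [_ h'] := hc y; apply: connect_trans h h'.
move=> s s2 /andP[cs us].
(* A cycle would visit all three vertices; rotated to start at [a], it has [b] next to [a], although
   they are not adjacent. *)
have sub : {subset s <= [:: a; b; c]} by move=> x _; rewrite !inE.
have [hs e] := uniq_min_size us sub s2.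
have as_ : a \in s by rewrite e mem_head.
have bs : b \in s by rewrite e !inE eqxx orbT.
have [i s' hrot] := rot_to as_.
move: cs bs hs; rewrite -(rot_cycle i) -(mem_rot i) -(size_rot i) hrot.
case: s' {hrot} => [|p [|q [|]]] //= /and4P[ap pq qa _].
rewrite !inE eq_sym (negbTE ab) /= => /orP[] /eqP hb _.
  by rewrite hb ap in nab.
by rewrite hb adj_sym qa in nab.
Qed.

End Shapes.

(** * The transition matrix *)

Section Transition.
Variables (R : realType) (X : sgraph) (P : 'M[R[i]]_#|X|) (d : 'rV[R]_#|X|).
Hypothesis Pu : P \is unitarymx.
Hypothesis Ld : lap X R[i] = invmx P *m diag_mx (map_mx (real_complex R) d) *m P.
Implicit Types (t : R) (v : 'cV[R[i]]_#|X|).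
Let U t : 'M[R[i]]_#|X| := transition_mx X t.

Lemma LdZ : map_mx intr (lap X int) =
  invmx P *m diag_mx (map_mx (real_complex R) d) *m P.
Proof. by rewrite (map_lap X (intr : {rmorphism int -> R[i]})). Qed.

Lemma transition_diag (Q : 'M[R[i]]_#|X|) t : Q \in unitmx ->
  lap X R[i] = invmx Q *m diag_mx (map_mx (real_complex R) d) *m Q ->
  U t = invmx Q *m diag_mx (\row_j cis (t * d 0 j)) *m Q.
Proof. by move=> Qu LQ; rewrite /U /transition_mx laplacian_mxE LQ expmx_diag. Qed.

Lemma scoord_transition t v j :
  scoord P (U t *m v) j = cis (t * d 0 j) * scoord P v j.
Proof.
rewrite /scoord (transition_diag t (unitarymx_unit Pu) Ld) !mulmxA.
rewrite mulmxV ?unitarymx_unit // mul1mx -mulmxA mul_diag_mx.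
by rewrite !mxE.
Qed.

Lemma transitionKN t v : U t *m (U (- t) *m v) = v.
Proof.
apply: (scoord_inj Pu) => j; rewrite !scoord_transition mulrA -cisD.
by rewrite mulNr addrN cis0 mul1r.
Qed.

(** The Laplacian and [d] are real, so the conjugate of [P] diagonalises it as well. Comparing the
    two diagonalisations gives the conjugate and the transpose of [U t]. *)
Let Q := map_mx (@conjc R) P.

Lemma conj_unitary : Q \in unitmx.
Proof. by rewrite map_unitmx unitarymx_unit. Qed.

Lemma conj_diag : lap X R[i] = invmx Q *m diag_mx (map_mx (real_complex R) d) *m Q.
Proof.
rewrite -[LHS](map_lap X (@conjc R : {rmorphism R[i] -> R[i]})) Ld !map_mxM map_invmx.
rewrite map_diag_mx.
have -> : map_mx (@conjc R) (map_mx (real_complex R) d) = map_mx (real_complex R) d.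
  by apply/rowP => j; rewrite !mxE /= oppr0.
by [].
Qed.

Lemma transition_conj t : map_mx (@conjc R) (U t) = U (- t).
Proof.
rewrite (transition_diag (- t) conj_unitary conj_diag).
rewrite (transition_diag t (unitarymx_unit Pu) Ld) !map_mxM map_invmx.
rewrite map_diag_mx.
have -> : map_mx (@conjc R) (\row_j cis (t * d 0 j)) = \row_j cis (- t * d 0 j).
  by apply/rowP => j; rewrite !mxE [LHS]cis_conj mulNr.
by [].
Qed.

Lemma transition_sym t : (U t)^T = U t.
Proof.
rewrite [RHS](transition_diag t conj_unitary conj_diag).
rewrite (transition_diag t (unitarymx_unit Pu) Ld) !trmx_mul tr_diag_mx.
have e : (invmx P)^T = Q.
  by rewrite (invmx_unitary Pu) map_trmx trmxK.
have e2 : P^T = invmx Q by rewrite -e -trmx_inv invmxK.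
by rewrite e e2 mulmxA.
Qed.

(** An eigenvector for [th] has nonzero spectral coordinates only where [d 0 j = th]. *)
Lemma transition_eigen t (th : R) v : lap X R[i] *m v = th%:C *: v ->
  U t *m v = cis (t * th) *: v.
Proof.
move=> Lv; apply: (scoord_inj Pu) => j; rewrite scoord_transition scoordZ.
have := scoord_mul Pu LdZ v j.
rewrite (map_lap X (intr : {rmorphism int -> R[i]})) Lv scoordZ.
have [->|h /(mulIf h)/complexI ->//] := eqVneq (scoord P v j) 0.
by rewrite !mulr0.
Qed.

Lemma scoord_dot (x y : 'cV[R[i]]_#|X|) :
  \sum_u (entry x u)^* * entry y u = \sum_j (scoord P x j)^* * scoord P y j.
Proof.
have PP : P^t* *m P = 1%:M by rewrite -invmx_unitary // mulVmx // unitarymx_unit.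
have dotE (a b : 'cV[R[i]]_#|X|) :
  (a^t* *m b) 0 0 = \sum_j (a j 0)^* * b j 0.
  by rewrite mxE; apply: eq_bigr => j _; rewrite !mxE.
rewrite /scoord -dotE trmx_mul map_mxM mulmxA -(mulmxA (x^t*)) PP mulmx1 dotE.
by rewrite [RHS](reindex (@enum_rank X)) //; exact/onW_bij/enum_rank_bij.
Qed.

(** Adding the form to itself with the ends of every edge exchanged produces a sum of the squared
    moduli of [x_u - x_w]. *)
Lemma lap_form_ge0 (x : 'cV[R[i]]_#|X|) :
  0 <= \sum_u (entry x u)^* * entry (lap X R[i] *m x) u.
Proof.
pose T := \sum_u \sum_(w | adj u w) (entry x u)^* * (entry x u - entry x w).
have -> : \sum_u (entry x u)^* * entry (lap X R[i] *m x) u = T.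
  by apply: eq_bigr => u _; rewrite entry_lap mulr_sumr.
have T' : T = \sum_u \sum_(w | adj u w) (entry x w)^* * (entry x w - entry x u).
  rewrite /T (exchange_big_dep predT) //=; apply: eq_bigr => u _.
  by apply: eq_bigl => w; rewrite adj_sym.
rewrite -(pmulrn_lge0 _ (isT : 0 < 2)%N) mulr2n {2}T' /T -big_split /=.
apply: sumr_ge0 => u _; rewrite -big_split /=; apply: sumr_ge0 => w _.
have -> : (entry x u)^* * (entry x u - entry x w) +
  (entry x w)^* * (entry x w - entry x u) =
  (entry x u - entry x w) * (entry x u - entry x w)^*.
  by rewrite rmorphB /=; ring.
exact: mulcJ_ge0.
Qed.

Lemma lap_eig_ge0 j : 0 <= d 0 j.
Proof.
pose v := invmx P *m delta_mx j 0 : 'cV_#|X|.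
have cv k : scoord P v k = (k == j)%:R.
  by rewrite /scoord mulKVmx ?unitarymx_unit // mxE eqxx andbT.
have := lap_form_ge0 v; rewrite scoord_dot -(map_lap X (intr : {rmorphism int -> R[i]})).
rewrite (bigD1 j) //= big1 => [|k kj].
  by rewrite (scoord_mul Pu LdZ) cv eqxx addr0 conjC_nat mul1r mulr1 lecR.
by rewrite cv (negbTE kj) conjC_nat mul0r.
Qed.

End Transition.

(** * Integrality of the eigenvalue support *)

Section Rational.
Variable R : realType.
Implicit Types x y : R.

Definition is_rat x := exists q : rat, x = ratr q.

Lemma is_rat_int (m : int) : is_rat m%:~R.
Proof. by exists m%:~R; rewrite ratr_int. Qed.

Lemma is_ratD x y : is_rat x -> is_rat y -> is_rat (x + y).
Proof. by move=> [p ->] [q ->]; exists (p + q); rewrite rmorphD. Qed.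

Lemma is_ratB x y : is_rat x -> is_rat y -> is_rat (x - y).
Proof. by move=> [p ->] [q ->]; exists (p - q); rewrite rmorphB. Qed.

Lemma is_ratM x y : is_rat x -> is_rat y -> is_rat (x * y).
Proof. by move=> [p ->] [q ->]; exists (p * q); rewrite rmorphM. Qed.

Lemma is_ratV x : is_rat x -> is_rat x^-1.
Proof. by move=> [p ->]; exists p^-1; rewrite fmorphV. Qed.

Lemma is_rat_sum (s : seq R) (f : R -> R) :
  (forall x, x \in s -> is_rat (f x)) -> is_rat (\sum_(x <- s) f x).
Proof.
move=> h; rewrite big_seq; elim/big_ind: _ => //; first exact: (is_rat_int 0).
exact: is_ratD.
Qed.
End Rational.

Section Integrality.
Variables (R : realType) (n : nat) (M : 'M[int]_n) (P : 'M[R[i]]_n) (d : 'rV[R]_n).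
Hypothesis Pu : P \is unitarymx.
Hypothesis Ldiag : map_mx intr M =
  invmx P *m diag_mx (map_mx (real_complex R) d) *m P.
Hypothesis d_ge0 : forall j, 0 <= d 0 j.
Variables (tau : R) (z : 'cV[int]_n).
Hypothesis tau0 : tau != 0.

Lemma esupp_is_rat_int t : t \in esupp P d z -> is_rat t -> exists m : int, t = m%:~R.
Proof.
move=> tz [q e]; rewrite e in tz *.
have /intrP[m ->] := esupp_rat_int Pu Ldiag tz.
by exists m; rewrite ratr_int.
Qed.

Lemma period_multiple t : cis (tau * t) = 1 ->
  exists k : int, t = k%:~R * (pi *+ 2 / tau).
Proof.
move=> /cis_eq1P[k hk]; exists k.
by rewrite mulrA -hk mulrC mulKf.
Qed.

(** Each supporting eigenvalue is an integer multiple of [rho], hence so is their sum [S]. [S] is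
    rational, and nonzero because no eigenvalue is negative and one in the support is positive; so
    [rho] is rational, and rational supporting eigenvalues are integers. *)
Lemma esupp_int_period : (forall t, t \in esupp P d z -> cis (tau * t) = 1) ->
  (exists2 t, t \in esupp P d z & t != 0) ->
  is_rat (pi *+ 2 / tau) /\ forall t, t \in esupp P d z -> exists m : int, t = m%:~R.
Proof.
move=> h1 [t0 t0z t00]; set rho := pi *+ 2 / tau.
have hge t : t \in esupp P d z -> 0 <= t by move=> /esuppP[j _ ->].
have [q hq] := esupp_sum_rat Pu Ldiag z.
set S := \sum_(t <- esupp P d z) t in hq.
have S0 : S != 0.
  rewrite /S big_seq psumr_neq0; last exact: hge.
  by apply/hasP; exists t0 => //=; rewrite t0z lt_def t00 hge.
have [K hK] : exists K : int, S = K%:~R * rho.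
  rewrite /S big_seq; elim/big_ind: _ => [|x y [k ->] [l ->]|t tz].
  - by exists 0; rewrite mul0r.
  - by exists (k + l); rewrite intrD mulrDl.
  - exact/period_multiple/h1.
have rr : is_rat rho.
  have -> : rho = S / K%:~R.
    rewrite hK mulrC mulKf //; apply: contra_neq S0 => e.
    by rewrite hK e mul0r.
  by apply: is_ratM; [exists q|apply/is_ratV/is_rat_int].
split=> // t tz; apply: esupp_is_rat_int => //.
by have [k ->] := period_multiple (h1 _ tz); apply: is_ratM => //; exact: is_rat_int.
Qed.

(** Two supporting eigenvalues differ by an integer multiple of the rational [2 pi / tau]. Averaging
    over the support recovers [t] from these differences and the rational sum. *)
Lemma esupp_int_phase w : is_rat (pi *+ 2 / tau) ->
  (forall t, t \in esupp P d z -> cis (tau * t) = w) ->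
  forall t, t \in esupp P d z -> exists m : int, t = m%:~R.
Proof.
move=> rr h t tz; apply: esupp_is_rat_int => //.
have diff x : x \in esupp P d z -> is_rat (x - t).
  move=> xz; have : cis (tau * (x - t)) = 1.
    apply: (mulIf (cis_neq0 (tau * t))).
    by rewrite -cisD -mulrDr subrK mul1r (h _ xz) (h _ tz).
  by move/period_multiple => [k ->]; apply: is_ratM => //; exact: is_rat_int.
have [q hq] := esupp_sum_rat Pu Ldiag z.
pose m := size (esupp P d z).
have m0 : m%:R != 0 :> R.
  by rewrite pnatr_eq0 /m; case: (esupp P d z) tz.
have -> : t = (\sum_(x <- esupp P d z) x - \sum_(x <- esupp P d z) (x - t)) / m%:R.
  rewrite sumrB opprB addrC subrK big_const_seq count_predT iter_addr_0.
  by rewrite -[t *+ _]mulr_natr mulfK.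
apply: is_ratM; last by apply: is_ratV; have := is_rat_int R m.
by apply: is_ratB; [exists q|exact: is_rat_sum].
Qed.

(** Turns an integral support into a list over [int], to which [shift_prod] for the integer matrix
    applies. *)
Lemma esupp_floor : (forall t, t \in esupp P d z -> exists m : int, t = m%:~R) ->
  map intr (map Num.floor (esupp P d z)) = esupp P d z.
Proof.
move=> h; rewrite -map_comp -[RHS]map_id; apply/eq_in_map => t tz /=.
by have [m ->] := h _ tz; rewrite intrKfloor.
Qed.

End Integrality.

(** * Fractional revival *)

(** Applying [U] to the expansion of [V *m x] gives a linear equation for [U *m y], solvable as
    [be'] is nonzero. It is meant for [V] the inverse of [U]. *)
Lemma span_stable (K : fieldType) n (U V : 'M[K]_n) (x y : 'cV[K]_n) al be al' be' :
  be' != 0 -> U *m x = al *: x + be *: y -> V *m x = al' *: x + be' *: y ->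
  U *m (V *m x) = x -> exists mu ga, U *m y = mu *: x + ga *: y.
Proof.
move=> be0 Ux ->; rewrite mulmxDr -!scalemxAr Ux => h.
exists (be'^-1 * (1 - al' * al)), (be'^-1 * - (al' * be)).
apply: (scalerI be0); rewrite scalerDr !scalerA !mulrA mulfV // !mul1r.
have -> : be' *: (U *m y) = x - al' *: (al *: x + be *: y).
  by rewrite -[X in X - _]h addrC addKr.
by rewrite scalerDr !scalerA scalerBl scale1r scaleNr opprD addrA.
Qed.

Section Revival.
Variables (R : realType) (X : sgraph).
Implicit Types (a b c : X) (t tau : R).

Lemma lap_spectral : exists (P : 'M[R[i]]_#|X|) (d : 'rV[R]_#|X|),
  P \is unitarymx /\ lap X R[i] = invmx P *m diag_mx (map_mx (real_complex R) d) *m P.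
Proof.
apply: real_sym_spectral; first exact: lap_sym.
by move=> i j; rewrite !mxE realB ?realn // realrMn ?realn ?orbT.
Qed.

Lemma vertex_vecE a : vertex_vec R a = uvec R[i] a.
Proof. by []. Qed.

Lemma entry_transition_uvec t a b :
  entry (transition_mx X t *m uvec R[i] a) b =
  transition_mx X t (enum_rank b) (enum_rank a).
Proof. by rewrite /entry -colE !mxE. Qed.

(** The all-ones vector lies in the kernel of the Laplacian, so [U] fixes it, and [U] is
    symmetric. *)
Lemma transition_sum t (x : 'cV[R[i]]_#|X|) :
  \sum_u entry (transition_mx X t *m x) u = \sum_u entry x u.
Proof.
have [P [d [Pu Ld]]] := lap_spectral.
pose one : 'cV[R[i]]_#|X| := const_mx 1.
have sumE y : \sum_u entry y u = (one^T *m y) 0 0.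
  rewrite mxE (reindex (@enum_rank X)) /=; last exact/onW_bij/enum_rank_bij.
  by apply: eq_bigr => u _; rewrite !mxE mul1r.
have U1 : transition_mx X t *m one = one.
  rewrite (transition_eigen Pu Ld t (th := 0)); first by rewrite mulr0 cis0 scale1r.
  rewrite scale0r; apply: entry_inj => u; rewrite entry_lap /entry !mxE big1 // => w _.
  by rewrite !mxE subrr.
rewrite !sumE mulmxA -[_ *m transition_mx X t]trmxK trmx_mul trmxK.
by rewrite (transition_sym Pu Ld) U1.
Qed.

Lemma sum_entry_uvec (al be : R[i]) a b :
  \sum_u entry (al *: uvec R[i] a + be *: uvec R[i] b) u = al + be.
Proof.
under eq_bigr => u _ do rewrite !entryE.
rewrite big_split /= (bigD1 a) //= eqxx big1 => [|u /negbTE ->]; last by rewrite mulr0.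
rewrite (bigD1 b) //= eqxx big1 => [|u /negbTE ->]; last by rewrite mulr0.
by rewrite !addr0 !mulr1.
Qed.

(* Unitarity forces the column of [b] to be supported on [a, b] as well; symmetry
   and the preserved vector of ones then make the 2x2 block circulant. *)
Lemma revival_eigen a b tau : proper_laplacian_FR a b tau ->
  exists2 w : R[i], w != 1 &
    transition_mx X tau *m (uvec R[i] a + uvec R[i] b) = uvec R[i] a + uvec R[i] b /\
    transition_mx X tau *m (uvec R[i] a - uvec R[i] b) = w *: (uvec R[i] a - uvec R[i] b).
Proof.
move=> [/eqP ab [al [be [/eqP be0]]]]; rewrite !vertex_vecE => Ua.
have [P [d [Pu Ld]]] := lap_spectral.
set U := transition_mx X tau in Ua *.
have sab : al + be = 1.
  by rewrite -(sum_entry_uvec al be a b) -Ua transition_sum -[uvec _ a]scale1r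
    -[_ *: _]addr0 -(scale0r (uvec R[i] b)) sum_entry_uvec addr0.
have Uma : transition_mx X (- tau) *m uvec R[i] a =
    conjc al *: uvec R[i] a + conjc be *: uvec R[i] b.
  rewrite -(transition_conj Pu Ld).
  rewrite -[uvec _ a](map_uvec (@conjc R : {rmorphism R[i] -> R[i]})).
  rewrite -map_mxM -/U Ua map_mxD !map_mxZ.
  by rewrite !(map_uvec (@conjc R : {rmorphism R[i] -> R[i]})).
have cb0 : conjc be != 0 by rewrite conjc_eq0.
have [mu [ga Ub]] := span_stable cb0 Ua Uma (transitionKN Pu Ld tau (uvec R[i] a)).
have smg : mu + ga = 1.
  by rewrite -(sum_entry_uvec mu ga a b) -Ub transition_sum -[uvec _ b]scale1r
    -[_ *: _]add0r -(scale0r (uvec R[i] a)) sum_entry_uvec add0r.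
have mube : mu = be.
  have : entry (U *m uvec R[i] b) a = entry (U *m uvec R[i] a) b.
    by rewrite !entry_transition_uvec -[in RHS](transition_sym Pu Ld) mxE.
  rewrite Ua Ub !entryE !eqxx [b == a]eq_sym (negbTE ab).
  by rewrite !mulr1 !mulr0 addr0 add0r.
have gaal : ga = al.
  by apply: (addrI be); rewrite -{1}mube smg addrC sab.
(* The block has [al] on the diagonal and [be] off it; its eigenvalue on [e_a - e_b] is
   [al - be = 1 - 2 be]. *)
exists (al - be).
  rewrite -sab; apply/eqP => /addrI /eqP; rewrite eq_sym -addr_eq0 -mulr2n.
  by rewrite mulrn_eq0 (negbTE be0).
rewrite mulmxDr mulmxBr Ua Ub mube gaal; split.
  by rewrite addrACA -!scalerDl addrC [be + al]addrC sab !scale1r addrC.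
apply: entry_inj => u; rewrite !entryE; ring.
Qed.
End Revival.

Lemma int_even_or_odd (m : int) : exists k : int, m = 2 * k \/ m = 2 * k + 1.
Proof. by exists (m %/ 2)%Z; lia. Qed.

Lemma int_odd_neq0 (k : int) : 1 + 2 * k != 0.
Proof. lia. Qed.

Lemma int_ge3 (m : int) : 0 <= m -> m != 1 -> m != 2 -> m = 0 \/ 3 <= m.
Proof. lia. Qed.

(** * Trees with a third vertex: revival forces [P_3] *)

Section Forward.
Variables (R : realType) (X : sgraph) (P : 'M[R[i]]_#|X|) (d : 'rV[R]_#|X|).
Hypothesis Pu : P \is unitarymx.
Hypothesis Ld : lap X R[i] = invmx P *m diag_mx (map_mx (real_complex R) d) *m P.
Variables (a b : X) (tau : R) (w : R[i]).
Hypotheses (ab : a != b) (w1 : w != 1).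
Let s (K : nzRingType) : 'cV[K]_#|X| := uvec K a + uvec K b.
Let f (K : nzRingType) : 'cV[K]_#|X| := uvec K a - uvec K b.
Hypothesis Us : transition_mx X tau *m s R[i] = s R[i].
Hypothesis Uf : transition_mx X tau *m f R[i] = w *: f R[i].
Let LZ := lap X int.
Let LdZ' := LdZ Ld.

Lemma map_vsum : map_mx intr (s int) = s R[i].
Proof. by rewrite map_mxD !(map_uvec (intr : {rmorphism int -> R[i]})). Qed.

Lemma map_vdiff : map_mx intr (f int) = f R[i].
Proof. by rewrite map_mxB !(map_uvec (intr : {rmorphism int -> R[i]})). Qed.

Lemma phase_s t : t \in esupp P d (s int) -> cis (tau * t) = 1.
Proof.
move=> /esuppP[j]; rewrite map_vsum => sj ->; apply: (mulIf sj).
by rewrite -(scoord_transition Pu Ld) Us mul1r.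
Qed.

Lemma phase_f t : t \in esupp P d (f int) -> cis (tau * t) = w.
Proof.
move=> /esuppP[j]; rewrite map_vdiff => fj ->; apply: (mulIf fj).
by rewrite -(scoord_transition Pu Ld) Uf scoordZ.
Qed.

Lemma f_neq0 (K : comNzRingType) : f K != 0.
Proof.
apply/eqP => /(congr1 (fun x => entry x a)); rewrite !entryE eqxx (negbTE ab) subr0.
by rewrite /entry mxE => /eqP; rewrite oner_eq0.
Qed.

Lemma tau_neq0 : tau != 0.
Proof.
apply: contra_neq w1 => t0; have := Uf; rewrite t0.
have -> : transition_mx X 0 *m f R[i] = f R[i].
  apply: (scoord_inj Pu) => j; rewrite (scoord_transition Pu Ld).
  by rewrite mul0r cis0 mul1r.
move=> /eqP; rewrite -subr_eq0 -{1}[f _]scale1r -scalerBl scaler_eq0.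
by rewrite (negbTE (f_neq0 _)) orbF subr_eq0 => /eqP.
Qed.

(** [U] is symmetric and fixes [s], so pairing [U x = cis (tau * t) x] with [s] gives
    [<s, x> = cis (tau * t) <s, x>]. *)
Lemma eigen_phase (t : R) (x : 'cV[R[i]]_#|X|) :
  lap X R[i] *m x = t%:C *: x -> cis (tau * t) != 1 -> entry x a + entry x b = 0.
Proof.
move=> Lx ct; have Ux := transition_eigen Pu Ld tau Lx.
have dotE (y : 'cV[R[i]]_#|X|) : ((s R[i])^T *m y) 0 0 = entry y a + entry y b.
  by rewrite /s linearD /= mulmxDl /uvec !trmx_delta -!rowE !mxE.
have := congr1 (mulmx (s R[i])^T) Ux.
rewrite mulmxA -[_^T *m transition_mx _ _]trmxK trmx_mul trmxK (transition_sym Pu Ld) Us.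
move/(congr1 (fun B : 'M[R[i]]_1 => B 0 0)); rewrite !dotE !entryZ -mulrDr => /eqP.
rewrite -subr_eq0 -{1}[_ + entry x b]mul1r -mulrBl mulf_eq0 subr_eq0 eq_sym.
by rewrite (negbTE ct) => /eqP.
Qed.

Hypothesis Xtree : is_tree X.
Let Xconn : connected_graph X := Xtree.1.
Let Xacyc : acyclic_graph X := Xtree.2.
Variable c0 : X.
Hypotheses (c0a : c0 != a) (c0b : c0 != b).

Lemma esupp_s_neq0 : exists2 t, t \in esupp P d (s int) & t != 0.
Proof.
have [/hasP[t ts t0]|/hasPn h] := boolP (has (fun t => t != 0) (esupp P d (s int))).
  by exists t.
have := @shift_prod_eq0 _ _ LZ _ _ Pu LdZ' (s int) [:: 0] _.
rewrite /= scale0r subr0 => L0.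
have : LZ *m s int = 0.
  by apply: L0 => t /h /negPn/eqP ->; rewrite inE.
(* Divisibility by 0 is equality, so [L s = 0] would make [s] constant; but [s] is 1 at [a] and 0 at
   [c0]. *)
move=> L0'; have := @lap_dvd X Xacyc Xconn 0 (entry (s int)) _ a c0.
rewrite !entryE eqxx (negbTE ab) (negbTE c0a) (negbTE c0b) /= => h0.
exfalso; have : (0 %| (1 + 0 - (0 + 0) : int))%Z.
  apply: h0 => u; rewrite -entry_lap -/LZ L0' /entry mxE.
  exact: dvdz0.
by [].
Qed.

Lemma s_int_period : is_rat (pi *+ 2 / tau) /\
  forall t, t \in esupp P d (s int) -> exists m : int, t = m%:~R.
Proof.
apply: (esupp_int_period Pu LdZ' (lap_eig_ge0 Pu Ld) tau_neq0).
- exact: phase_s.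
- exact: esupp_s_neq0.
Qed.

Lemma f_int t : t \in esupp P d (f int) -> exists m : int, t = m%:~R.
Proof.
apply: (esupp_int_phase Pu LdZ' tau_neq0 s_int_period.1 (w := w)).
exact: phase_f.
Qed.

(** A supporting eigenvalue is an integer [m], positive because [w] is not 1. Removing the other
    eigenvalues from [f] by [shift_prod] leaves a nonzero integer eigenvector for [m], with opposite
    values at [a] and [b] by [eigen_phase]; [eigenvalue_antisym] then excludes [m > 2]. *)
Lemma esupp_f12 t : t \in esupp P d (f int) -> t \in map intr [:: 1; 2 : int].
Proof.
move=> tf; have [m e] := f_int tf.
have t_ge0 : 0 <= t by have /esuppP[j _ ->] := tf; apply: lap_eig_ge0 Pu Ld j.
have t0 : t != 0.
  by apply: contraNneq w1 => t0; rewrite -(phase_f tf) t0 mulr0 cis0.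
have m_gt0 : 0 < m.
  by rewrite -(ltr_int R) -e lt_def t0.
have [m2|m2] := leP m 2.
  by rewrite e; apply: map_f; rewrite !inE; lia.
exfalso.
pose l := map Num.floor (esupp P d (f int)).
have el : map intr l = esupp P d (f int) :> seq R := esupp_floor f_int.
have ml : m \in l by rewrite -(mem_map (@intr_inj R)) el -e.
have ul : uniq l by rewrite -(map_inj_uniq (@intr_inj R)) el undup_uniq.
pose x := shift_prod LZ (rem m l) (f int).
have Lx : LZ *m x = m *: x.
  apply/eqP; rewrite -subr_eq0; apply/eqP.
  apply: (@shift_prod_eq0 _ _ LZ _ _ Pu LdZ' (f int) (m :: rem m l)) => y.
  by rewrite -el => /mapP[k kl ->]; apply: map_f; rewrite -(perm_mem (perm_to_rem ml)).
have x0 : x != 0.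
  apply: (shift_prod_neq0 Pu LdZ' (z := f int) tf).
  by rewrite e (mem_map (@intr_inj R)) mem_rem_uniq // inE eqxx.
have xab : entry x a + entry x b = 0.
  apply: (@intr_inj R[i]); rewrite intrD.
  have := @eigen_phase t (map_mx intr x) _ _.
  rewrite /entry !mxE; apply; last by rewrite (phase_f tf).
  rewrite -(map_lap X (intr : {rmorphism int -> R[i]})) -map_mxM Lx map_mxZ e.
  by rewrite rmorph_int.
case/negP: x0; apply/eqP; apply: entry_inj => u.
rewrite [RHS]/entry mxE; apply: (eigenvalue_antisym Xacyc Xconn m2 _ xab) => v.
by rewrite -entry_lap -/LZ Lx entryZ.
Qed.

Lemma quadratic_f : LZ *m (LZ *m f int - 2 *: f int) = LZ *m f int - 2 *: f int.
Proof.
have := @shift_prod_eq0 _ _ LZ _ _ Pu LdZ' (f int) [:: 1; 2] esupp_f12.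
by rewrite /= scale1r => /eqP; rewrite subr_eq0 => /eqP.
Qed.

Lemma forward_cherry : exists c, is_cherry_graph a b c.
Proof.
have [da [db h]] := quadratic_dichotomy Xacyc ab quadratic_f.
case: h => [aab|[nab [c ac bc]]].
  (* Two adjacent leaves form a whole component, which misses [c0]. *)
  exfalso; have := @connected_closed X [pred x | (x == a) || (x == b)] a Xconn _ _ c0.
  rewrite /= eqxx (negbTE c0a) (negbTE c0b) => h; suff: false by []; apply: h => // u v.
  case/orP=> /eqP -> => [av|bv].
    by rewrite (degree1_unique da aab av) eqxx orbT.
  by rewrite adj_sym in aab; rewrite (degree1_unique db aab bv) eqxx.
exists c; split=> //.
(* If [c] has no neighbour besides [a] and [b], these three vertices are closed under adjacency; the
   rest of the proof excludes a further neighbour [v]. *)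
have [/existsP[v /and3P[cv va vb]]|nv] :=
  boolP [exists v, [&& adj c v, v != a & v != b]]; last first.
  apply: (@connected_closed X [pred x | [|| x == a, x == b | x == c]] a Xconn) => /=.
    move=> u v /or3P[] /eqP -> h.
    - by rewrite (degree1_unique da ac h) eqxx !orbT.
    - by rewrite (degree1_unique db bc h) eqxx !orbT.
    - move: nv; rewrite negb_exists => /forallP/(_ v); rewrite h /= negb_and !negbK.
      by case/orP=> ->; rewrite ?orbT.
  by rewrite eqxx.
exfalso.
have va' := adj_neq ac; have vc' := adj_neq cv.
have Lf (K : comNzRingType) : lap X K *m f K = f K.
  by rewrite mulmxBr (lap_leaf K da ac) (lap_leaf K db bc) opprB addrA subrK.
have Ls (K : comNzRingType) : lap X K *m s K = s K - 2 *: uvec K c.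
  rewrite mulmxDr (lap_leaf K da ac) (lap_leaf K db bc) /s scaler_nat mulr2n opprD.
  by rewrite addrACA.
(* [L f = f] identifies [w] with [cis tau]; hence 1 cannot support [s]. *)
have cis1 : cis tau != 1.
  have := transition_eigen Pu Ld tau (th := 1) (v := f R[i]).
  rewrite Lf scale1r mulr1 => /(_ erefl); rewrite Uf => /eqP.
  rewrite -subr_eq0 -scalerBl scaler_eq0 (negbTE (f_neq0 _)) orbF subr_eq0.
  by move=> /eqP <-.
have intS := s_int_period.2.
pose l := map Num.floor (esupp P d (s int)).
have el : map intr l = esupp P d (s int) :> seq R := esupp_floor intS.
have cisl m : m \in l -> cis (tau * m%:~R) = 1.
  by move=> ml; apply: phase_s; rewrite -el map_f.
have [l2|l2] := boolP (2 \in l).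
  (* With [cis (2 tau) = 1], an odd supporting eigenvalue would give [cis tau = 1]. *)
  have even m : m \in l -> exists k, m = 2 * k.
    move=> ml; have [k [->|mk]] := int_even_or_odd m; first by exists k.
    have /cis_eq1P[j hj] := cisl _ l2.
    case/negP: cis1; apply/eqP.
    have := cisl _ ml; rewrite mk intrD intrM mulrDr mulr1 cisD mulrA hj mulrAC.
    by rewrite -intrM cis_2pi_int mul1r.
  have : shift_prod LZ l (s int) = 0.
    by apply: (@shift_prod_eq0 _ _ LZ _ _ Pu LdZ' (s int)); rewrite el.
  (* Modulo 2, [L s = s] and every [m] in [l] is 0, so each factor [L - m] fixes [s]. *)
  have [y ->] : exists y, shift_prod LZ l (s int) = s int + 2 *: y.
    elim: l even {el cisl l2} => [|m l IH] even.
      by exists 0; rewrite scaler0 addr0.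
    have [|y hy] := IH; first by move=> k kl; apply: even; rewrite inE kl orbT.
    have [k ->] := even m (mem_head _ _).
    exists (LZ *m y - uvec int c - k *: (s int + 2 *: y)).
    rewrite /= hy mulmxDr Ls -scalemxAr.
    by apply: entry_inj => u; rewrite !entryE; ring.
  move=> /(congr1 (fun x => entry x a)).
  rewrite !entryE eqxx (negbTE ab) [entry 0 a]/entry mxE addr0 => /eqP.
  exact/negP/int_odd_neq0.
have l03 t : t \in esupp P d (s int) -> t = 0 \/ 3 <= t.
  move=> ts; have [m e] := intS _ ts.
  have ml : m \in l by rewrite -(mem_map (@intr_inj R)) el -e.
  have m0 : 0 <= m.
    by rewrite -(ler_int R) -e; have /esuppP[j _ ->] := ts; apply: lap_eig_ge0 Pu Ld j.
  have m1 : m != 1.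
    by apply: contraNneq cis1 => m1; rewrite -(cisl _ ml) m1 mulr1.
  have m2 : m != 2 by apply: contraNneq l2 => <-.
  by rewrite e; case: (int_ge3 m0 m1 m2) => [->|m3];
    [left | right; rewrite (ler_int R 3 m)].
(* [y = L (L - 3) s] is shown to vanish at [a] and [b], where [s] lives, so that [<s, y> = 0]. *)
pose y := shift_prod LZ [:: 0; 3] (s int).
have yE : y = - 2 *: (s int - 2 *: uvec int c) - 2 *: (LZ *m uvec int c).
  rewrite /y /= scale0r subr0 Ls.
  have -> : s int - 2 *: uvec int c - 3 *: s int = - 2 *: (s int + uvec int c).
    by apply: entry_inj => u; rewrite !entryE; ring.
  by rewrite -scalemxAr mulmxDr Ls; apply: entry_inj => u;
    rewrite !(entryD, entryN, entryZ); ring.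
have yleaf u : u != c -> adj u c -> degree u = 1%N ->
    (u == a)%:R + (u == b)%:R = 1 :> int -> entry y u = 0.
  move=> uc auc du su.
  by rewrite yE !(entryD, entryN, entryZ) entry_lap_uvec !entry_uvec
    su (negbTE uc) auc /=; ring.
have ya : entry y a = 0.
  by apply: yleaf; rewrite // eqxx (negbTE ab).
have yb : entry y b = 0.
  by apply: yleaf; rewrite ?(adj_neq bc) // eqxx eq_sym (negbTE ab).
have y0 : y = 0.
  apply: (@shift_prod_eq0 _ _ LZ _ _ Pu LdZ' (s int)) => t ts.
  have [->|t3] := l03 t ts; first by rewrite inE eqxx.
  suff -> : t = 3 by rewrite !inE eqxx orbT.
  (* In spectral coordinates [<s, y>] is the sum of the [T j], all nonnegative since supporting
     eigenvalues are 0 or at least 3. All terms thus vanish, which turns at least 3 into exactly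
     3. *)
  pose D x : R := x * (x - 3).
  pose T j := `|scoord P (map_mx intr (s int)) j| ^+ 2 * (D (d 0 j))%:C.
  have T_ge0 j : 0 <= T j.
    have [w0|w0] := eqVneq (scoord P (map_mx intr (s int)) j) 0.
      by rewrite /T w0 normr0 expr0n mul0r.
    rewrite mulr_ge0 ?exprn_ge0 // lecR /D.
    have dj : d 0 j \in esupp P d (s int) by apply/esuppP; exists j.
    by case: (l03 _ dj) => [->|h3]; [rewrite mul0r|apply: mulr_ge0; lra].
  have T0 : \sum_j T j = 0.
    have := scoord_dot Pu (map_mx intr (s int)) (map_mx intr y).
    have -> : \sum_u (entry (map_mx intr (s int)) u)^* *
        entry (map_mx intr y) u = 0 :> R[i].
      rewrite (bigD1 a) // (bigD1 b) 1?eq_sym //= big1 => [|u /andP[ua ub]].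
        by rewrite /entry ![map_mx intr y _ _]mxE -/(entry y a)
          -/(entry y b) ya yb !mulr0 !addr0.
      have -> : entry (map_mx intr (s int)) u = 0 :> R[i].
        by rewrite map_vsum !entryE (negbTE ua) (negbTE ub) addr0.
      by rewrite rmorph0 mul0r.
    move=> e; rewrite [RHS]e; apply: eq_bigr => j _; rewrite /T /y map_shift_prod.
    have -> : (D (d 0 j))%:C = ((d 0 j)%:C - 0%:~R) * ((d 0 j)%:C - 3%:~R).
      by rewrite /D rmorphM rmorphB subr0 rmorph_nat.
    rewrite (scoord_shift_prod Pu LdZ') !big_cons big_nil mulr1 normCK.
    by rewrite [LHS]mulrC mulrA [LHS]mulrC.
  have /esuppP[j wj tj] := ts.
  have := @psumr_eq0P _ _ predT T (fun j _ => T_ge0 j) T0 j isT.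
  move/eqP; rewrite mulf_eq0 expf_eq0 /= normr_eq0 (negbTE wj) /= => /eqP/complexI/eqP.
  rewrite /D -tj mulf_eq0 subr_eq0 => /orP[|] /eqP // h.
  by move: t3; rewrite h; lra.
(* At [v] both [s] and [e_c] vanish while [L e_c] is -1, so [y] takes the value 2 there. *)
have := congr1 (fun x => entry x v) y0.
rewrite /= yE !(entryD, entryN, entryZ) entry_lap_uvec !entry_uvec (negbTE va) (negbTE vb).
rewrite [v == c]eq_sym (negbTE vc') adj_sym cv [X in _ = X]/entry mxE => h.
have : 2 = 0 :> int by rewrite -[RHS]h /=; ring.
by [].
Qed.

End Forward.

(** * The shape of a tree with revival, and revival on [K_2] and [P_3] *)

Section Converse.
Variables (R : realType) (X : sgraph).
Implicit Types (a b c : X).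

Lemma revival_shape a b (tau : R) : is_tree X -> proper_laplacian_FR a b tau ->
  is_edge_graph a b \/ exists c, is_cherry_graph a b c.
Proof.
move=> Xtree FR; have /eqP ab := FR.1.
have [P [d [Pu Ld]]] := lap_spectral R X.
have [w w1 [Us Uf]] := revival_eigen FR.
have [/existsP[c0 /andP[ca cb]]|no] := boolP [exists c0, (c0 != a) && (c0 != b)].
  by right; exact: (forward_cherry Pu Ld ab w1 Us Uf Xtree ca cb).
have all x : (x == a) || (x == b).
  by move: no; rewrite negb_exists => /forallP/(_ x); rewrite negb_and !negbK.
left; split=> //; have /connectP[[|y p] /=] := Xtree.1.2 a b.
  by move=> _ e; rewrite e eqxx in ab.
move=> /andP[ay _] _; have /orP[] := all y => /eqP e; rewrite e in ay => //.
by rewrite adj_irrefl in ay.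
Qed.

(** [e_a] is half the sum of [e_a + e_b] and [e_a - e_b], which [U] multiplies by 1 and [w]. *)
Lemma revival_of_eigen a b (tau : R) (w : R[i]) : a != b -> w != 1 ->
  transition_mx X tau *m (uvec R[i] a + uvec R[i] b) = uvec R[i] a + uvec R[i] b ->
  transition_mx X tau *m (uvec R[i] a - uvec R[i] b) = w *: (uvec R[i] a - uvec R[i] b) ->
  proper_laplacian_FR a b tau.
Proof.
move=> ab w1 Us Uf; split; first exact/eqP.
exists ((1 + w) / 2), ((1 - w) / 2); split.
  by apply/eqP; rewrite mulf_neq0 ?invr_eq0 ?pnatr_eq0 // subr_eq0 eq_sym.
rewrite !vertex_vecE.
have h2 : (2 : R[i]) != 0 by rewrite pnatr_eq0.
have ea : uvec R[i] a = 2^-1 *: ((uvec R[i] a + uvec R[i] b) + (uvec R[i] a - uvec R[i] b)).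
  by apply: entry_inj => u; rewrite !entryE; field.
rewrite [in LHS]ea -scalemxAr mulmxDr Us Uf.
by apply: entry_inj => u; rewrite !entryE; field.
Qed.

(** The eigenvalues of [K_2] are 0 on [e_a + e_b] and 2 on [e_a - e_b]; at time [pi / 2] the latter
    has phase [cis pi = -1]. *)
Lemma edge_graph_revival a b : is_edge_graph a b -> proper_laplacian_FR a b (pi / 2 : R).
Proof.
move=> [ab all]; have nab := adj_neq ab.
have [P [d [Pu Ld]]] := lap_spectral R X.
have deg (x y : X) : adj x y -> (forall z, (z == x) || (z == y)) -> degree x = 1%N.
  move=> xy h; rewrite /degree (eq_card (B := pred1 y)) ?card1 // => z.
  rewrite !inE /in_mem /=; have /orP[/eqP ->|/eqP ->] := h z.
    by rewrite adj_irrefl (negbTE (adj_neq xy)).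
  by rewrite xy eqxx.
have La := lap_leaf R[i] (deg _ _ ab all) ab.
have ba : adj b a by rewrite adj_sym.
have Lb : lap X R[i] *m uvec R[i] b = uvec R[i] b - uvec R[i] a.
  by apply: lap_leaf => //; apply: (deg _ _ ba) => z; rewrite orbC.
apply: (revival_of_eigen (w := -1)) => //.
- by rewrite eq_sym -addr_eq0 -[1 + 1]/(2%:R) pnatr_eq0.
- rewrite (transition_eigen Pu Ld _ (th := 0)) ?mulr0 ?cis0 ?scale1r //.
  by rewrite mulmxDr La Lb scale0r -[uvec _ b - _]opprB subrr.
- rewrite (transition_eigen Pu Ld _ (th := 2)); last first.
    rewrite mulmxBr La Lb rmorph_nat scaler_nat mulr2n.
    by rewrite opprB.
  rewrite divfK //; congr (_ *: _); apply/eqP.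
  by rewrite /cis eq_complex cospi sinpi /= oppr0 !eqxx.
Qed.

(** The eigenvalues of [P_3] are 0, 1 and 3, on [one], [e_a - e_b] and [g]. At time [2 pi / 3] the
    phases of 0 and 3 are 1, so the span of [one] and [g], which contains [e_a + e_b], is fixed; the
    phase of 1 is a nontrivial cube root of unity. *)
Lemma cherry_graph_revival a b c : is_cherry_graph a b c ->
  proper_laplacian_FR a b (pi *+ 2 / 3 : R).
Proof.
move=> [ab ac bc nab all].
have [P [d [Pu Ld]]] := lap_spectral R X.
have deg (x y : X) : ~~ adj x y -> adj x c -> (forall z, [|| z == x, z == y | z == c]) ->
    degree x = 1%N.
  move=> xy xc h; rewrite /degree (eq_card (B := pred1 c)) ?card1 // => z.
  rewrite !inE /in_mem /=; have /or3P[] := h z => /eqP ->.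
  - by rewrite adj_irrefl (negbTE (adj_neq xc)).
  - rewrite (negbTE xy); apply/esym/eqP => e; by rewrite e xc in xy.
  - by rewrite xc eqxx.
have La := lap_leaf R[i] (deg _ _ nab ac all) ac.
have Lb : lap X R[i] *m uvec R[i] b = uvec R[i] b - uvec R[i] c.
  apply: lap_leaf => //; apply: (deg b a) => //; first by rewrite adj_sym.
  by move=> z; rewrite orbCA.
pose one := uvec R[i] a + uvec R[i] b + uvec R[i] c.
have one1 u : entry one u = 1.
  have nac := adj_neq ac; have nbc := adj_neq bc.
  rewrite !entryE; have /or3P[] := all u => /eqP ->; rewrite eqxx ?(negbTE ab)
    ?(negbTE nac) ?(negbTE nbc) ?[b == a]eq_sym ?[c == a]eq_sym ?[c == b]eq_sym
    ?(negbTE ab) ?(negbTE nac) ?(negbTE nbc) /=; ring.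
have Lone : lap X R[i] *m one = 0.
  by apply: entry_inj => u; rewrite entry_lap [RHS]/entry mxE big1 // => z _;
    rewrite !one1 subrr.
have Lc : lap X R[i] *m uvec R[i] c =
  - (uvec R[i] a - uvec R[i] c + (uvec R[i] b - uvec R[i] c)).
  by apply/eqP; rewrite -addr_eq0 -La -Lb addrC -!mulmxDr Lone.
pose g := uvec R[i] a + uvec R[i] b - 2 *: uvec R[i] c.
have Uone : transition_mx X (pi *+ 2 / 3 : R) *m one = one.
  by rewrite (transition_eigen Pu Ld _ (th := 0)) ?mulr0 ?cis0 ?scale1r // scale0r.
have Ug : transition_mx X (pi *+ 2 / 3 : R) *m g = g.
  rewrite (transition_eigen Pu Ld _ (th := 3)).
    by rewrite divfK // -[pi *+ 2]mul1r (cis_2pi_int R 1) scale1r.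
  rewrite /g mulmxBr mulmxDr -scalemxAr La Lb Lc rmorph_nat.
  by apply: entry_inj => u; rewrite !entryE; ring.
apply: (revival_of_eigen (w := cis (pi *+ 2 / 3))) => //.
- apply/eqP => /cis_eq1P[k]; rewrite [LHS]mulrC => /mulIf h.
  have /h : (pi *+ 2 : R) != 0 by rewrite mulrn_eq0 /= gt_eqF ?pi_gt0.
  move=> /(congr1 (fun x => x * 3)); rewrite mulVf // => e.
  have : (1 : int)%:~R = (k * 3)%:~R :> R by rewrite intrM -e.
  by move/intr_inj; lia.
- have -> : uvec R[i] a + uvec R[i] b = (2 / 3) *: one + 3^-1 *: g.
    by apply: entry_inj => u; rewrite !entryE; field.
  by rewrite mulmxDr -!scalemxAr Uone Ug.
- rewrite (transition_eigen Pu Ld _ (th := 1)) ?mulr1 // scale1r.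
  by rewrite mulmxBr La Lb opprB addrA subrK.
Qed.

End Converse.

Theorem theorem10p3 (R : realType) (X : sgraph) :
  is_tree X /\ admits_proper_laplacian_FR R X <->
  graph_iso X (complete_graph 2) \/ graph_iso X (path_graph 3).
Proof.
split=> [[Xtree [a [b [tau FR]]]]|
  [/iso_edge_graph[a [b h]]|/iso_cherry_graph[a [b [c h]]]]].
- have [h|[c h]] := revival_shape Xtree FR.
    by left; exact: edge_graph_iso h.
  by right; exact: cherry_graph_iso h.
- split; first exact: edge_graph_tree h.
  by exists a, b, (pi / 2); exact: edge_graph_revival.
- split; first exact: cherry_graph_tree h.
  by exists a, b, (pi *+ 2 / 3); exact: cherry_graph_revival h.
Qed.
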